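(* Let $W\subseteq V=\mathbb{C}^E$ be a configuration with matroid $\mathsf{M}$, let $\mathcal{L}_{\mathsf{M}}$ be the lattice of flats of $\mathsf{M}$, and let $\mathbb{L}=[\mathbb{A}^1]$ be the class of the affine line. Then, in the Grothendieck ring of varieties $K_0(\mathrm{Var}_{\mathbb{C}})$, $$[\Lambda_W]=\sum_{F\in\mathcal{L}_{\mathsf{M}},\ F\neq E}\overline{\chi}_{\mathsf{M}/F}(\mathbb{L})\cdot\frac{\mathbb{L}^{|E|-\operatorname{rank}(\mathsf{M}\setminus F)}-1}{\mathbb{L}-1}.$$
   Context: $E=\{1,\dots,n\}$, $V=\mathbb{C}^E$ has basis $x_1,\dots,x_n$, and $V^\star$ has the dual basis $y_1,\dots,y_n$. For $v\in V$ put $v_i=y_i(v)$; for $\beta\in V^\star$ put $\beta_i=\beta(x_i)$. A configuration is a linear subspace $W\subseteq V$; $r=\dim W$, and it is assumed that $n>r>0$. Its matroid $\mathsf{M}_W$ on $E$ has as bases those $B\subseteq E$ for which the coordinate projection $W\to\mathbb{C}^B$ is an isomorphism. Put $\ell_i=y_i|_W$. $\Lambda_W\subseteq\mathbb{P}W\times\mathbb{P}V^\star$ (spaces of lines) is the subscheme of pairs $(w,\beta)$ defined by $\sum_{i\in E}\beta_iw_i\ell_i=0$ in $W^\star$. $\mathsf{M}/F$ and $\mathsf{M}\setminus F$ denote contraction and deletion of $F$. $\overline\chi_{\mathsf{N}}(t)=\chi_{\mathsf{N}}(t)/(t-1)$ is the reduced characteristic polynomial of a matroid $\mathsf{N}$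 of positive rank, $\chi_{\mathsf{N}}$ being its characteristic polynomial. The quotient $(\mathbb{L}^m-1)/(\mathbb{L}-1)$ means $1+\mathbb{L}+\cdots+\mathbb{L}^{m-1}$. *)

(* Defs.v *)
From HB Require Import structures.
From mathcomp Require Import all_boot all_order all_algebra.
From mathcomp Require Import boolp reals complex.
From mathcomp Require Import -(notations) monalg.
From mathcomp Require Import mpoly.

Set Implicit Arguments.
Unset Strict Implicit.
Unset Printing Implicit Defensive.

Import GRing.Theory.
Local Open Scope ring_scope.
Local Open Scope quotient_scope.

Section Matroid.
Variable E : finType.
Implicit Types (A B F : {set E}).

Definition basis_exchange (Bs : {set {set E}}) : Prop :=
  forall B1 B2, B1 \in Bs -> B2 \in Bs ->
  forall x, x \in B1 :\: B2 ->
  exists2 y, y \in B2 :\: B1 & y |: (B1 :\ x) \in Bs.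

(* The ground set is a subset of [E], so that deletions and contractions
   stay over the same type. *)
Record matroid := Matroid {
  ground : {set E};
  bases : {set {set E}};
  bases_ground : forall B, B \in bases -> B \subset ground;
  bases_neq0 : bases != set0;
  bases_exchange : basis_exchange bases }.

Implicit Type M : matroid.

Definition rank M A : nat := \max_(B in bases M) #|A :&: B|.

Definition rk M : nat := rank M (ground M).

Definition flat M F : bool :=
  (F \subset ground M) &&
  [forall x in ground M :\: F, (rank M F < rank M (x |: F))%N].

(* A basis of M \ F is a trace B :\: F of maximal size; a basis of M / F is the
   trace B :\: F of a basis B containing a basis of F. *)
Definition deletion_bases M F : {set {set E}} :=
  [set B :\: F | B in bases M & #|B :\: F| == rank M (ground M :\: F)].

Definition contraction_bases M F : {set {set E}} :=
  [set B :\: F | B in bases M & #|B :&: F| == rank M F].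

Lemma rank_max M A B : B \in bases M -> (#|A :&: B| <= rank M A)%N.
Proof. by move=> BM; rewrite /rank (bigmax_sup B). Qed.

Lemma rank_attained M A : exists2 B, B \in bases M & #|A :&: B| = rank M A.
Proof.
have /set0Pn[B0 B0M] := bases_neq0 M.
have := @eq_bigmax_cond _ (mem (bases M)) (fun B => #|A :&: B|).
case; first by apply/card_gt0P; exists B0.
by move=> B BM e; exists B => //; rewrite /rank e.
Qed.

Lemma contraction_ground M F B :
  B \in contraction_bases M F -> B \subset ground M :\: F.
Proof.
by case/imsetP=> C; rewrite inE => /andP[/bases_ground CM _] ->; apply: setSD.
Qed.

Lemma contraction_neq0 M F : contraction_bases M F != set0.
Proof.
have [B BM e] := rank_attained M F; apply/set0Pn; exists (B :\: F).
by apply: imset_f; rewrite inE BM setIC e eqxx.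
Qed.

Lemma contraction_exchange M F : basis_exchange (contraction_bases M F).
Proof.
move=> _ _ /imsetP[B1 + ->] /imsetP[B2 + ->].
rewrite !inE => /andP[B1M /eqP r1] /andP[B2M /eqP r2] x.
rewrite !inE => /andP[+ /andP[xF xB1]]; rewrite xF /= => xB2.
have [|y] := bases_exchange B1M B2M (x := x); first by rewrite !inE xB2.
rewrite !inE => /andP[yB1 yB2] BM.
have yF : y \notin F.
  apply/negP => yF; have := rank_max F BM; rewrite -r1 leqNgt => /negP[].
  apply: (@leq_trans #|y |: (B1 :&: F)|).
    by rewrite cardsU1 !inE (negPf yB1) /= add1n.
  apply/subset_leq_card/subsetP => z; rewrite !inE.
  case: eqVneq => [->|_] /=; first by rewrite yF.
  case/andP=> zB1 zF; rewrite zF zB1 /= andbT.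
  by apply: contraNneq xF => <-.
exists y; first by rewrite !inE (negPf yB1) yB2 yF.
apply/imsetP; exists (y |: (B1 :\ x)).
  rewrite inE BM /= -r1; apply/eqP; congr #|pred_of_set _|.
  apply/setP => z; rewrite !inE.
  case: eqVneq => [->|_] /=; first by rewrite (negPf yF) andbF.
  by case: eqVneq => [->|_] //=; rewrite (negPf xF) andbF.
apply/setP => z; rewrite !inE.
by case: eqVneq => [->|_] /=; [rewrite yF | case: (z == x); rewrite ?andbF].
Qed.

Definition contraction M F : matroid :=
  Matroid (@contraction_ground M F) (contraction_neq0 M F)
          (@contraction_exchange M F).

Lemma deletion_ground M F B :
  B \in deletion_bases M F -> B \subset ground M :\: F.
Proof.
by case/imsetP=> C; rewrite inE => /andP[/bases_ground CM _] ->; apply: setSD.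
Qed.

Lemma basisD M F B : B \in bases M -> (ground M :\: F) :&: B = B :\: F.
Proof.
move=> /bases_ground/subsetP BM; apply/setP => z; rewrite !inE -andbA.
by case: (boolP (z \in B)) => [/BM->|]; rewrite ?andbF ?andbT.
Qed.

Lemma deletion_neq0 M F : deletion_bases M F != set0.
Proof.
have [B BM e] := rank_attained M (ground M :\: F).
apply/set0Pn; exists (B :\: F).
by apply: imset_f; rewrite inE BM -e basisD ?eqxx.
Qed.

Lemma card_exchange (B : {set E}) x y :
  x \in B -> y \notin B -> #|y |: (B :\ x)| = #|B|.
Proof. by move=> xB yB; rewrite cardsU1 !inE (negPf yB) andbF (cardsD1 x B) xB. Qed.

Lemma bases_card M B1 B2 : B1 \in bases M -> B2 \in bases M -> #|B1| = #|B2|.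
Proof.
move=> h1 h2; wlog suff: B1 B2 h1 h2 / (#|B1| <= #|B2|)%N.
  by move=> h; apply/eqP; rewrite eqn_leq !h.
have [k] := ubnP #|B1 :\: B2|; elim: k B1 h1 => // k IH B1 h1 hk.
have [/eqP|/set0Pn[x xB]] := eqVneq (B1 :\: B2) set0.
  by rewrite setD_eq0; apply: subset_leq_card.
have [y yB BM] := bases_exchange h1 h2 xB.
move: xB yB; rewrite !inE => /andP[x2 x1] /andP[y1 y2].
rewrite -(card_exchange x1 y1); apply: IH => //.
rewrite -ltnS (leq_trans _ hk) // ltnS (cardsD1 x (B1 :\: B2)) !inE x2 x1 add1n ltnS.
apply/subset_leq_card/subsetP => z; rewrite !inE => /andP[z2].
by rewrite z2; case: eqVneq z2 => [->|_ _]; rewrite ?y2.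
Qed.

(* A basis with trace B2 :\: F outside F of maximal size can be changed inside F
   so as to agree there with B1. *)
Lemma deletion_align M F B1 B2 : B1 \in bases M -> B2 \in bases M ->
  #|B1 :\: F| = rank M (ground M :\: F) ->
  #|B2 :\: F| = rank M (ground M :\: F) ->
  exists2 B, B \in bases M & B :\: F = B2 :\: F /\ B :&: F = B1 :&: F.
Proof.
move=> h1 h2 r1 r2.
have [k] := ubnP #|(B2 :&: F) :\: B1|; elim: k B2 h2 r2 => // k IH B2 h2 r2 hk.
have [/eqP|/set0Pn[x]] := eqVneq ((B2 :&: F) :\: B1) set0.
  rewrite setD_eq0 => sub; exists B2 => //; split=> //.
  apply/eqP; rewrite eqEcard subsetI sub subsetIr /=.
  rewrite -(leq_add2r #|B1 :\: F|) cardsID r1 -r2 cardsID.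
  by rewrite (bases_card h1 h2).
rewrite !inE => /andP[x1 /andP[x2 xF]].
have [|y] := bases_exchange h2 h1 (x := x); first by rewrite !inE x1.
rewrite !inE => /andP[y2 y1] BM.
have yF : y \in F.
  apply/negPn/negP => yF.
  have := rank_max (ground M :\: F) BM; rewrite basisD // -r2 leqNgt => /negP[].
  apply: (@leq_trans #|y |: (B2 :\: F)|).
    by rewrite cardsU1 !inE (negPf y2) andbF add1n.
  apply/subset_leq_card/subsetP => z; rewrite !inE.
  case: eqVneq => [->|_] /=; first by rewrite yF.
  by case/andP=> zF ->; rewrite zF andbT; apply: contraNneq zF => ->.
have e : (y |: (B2 :\ x)) :\: F = B2 :\: F.
  apply/setP => z; rewrite !inE; case: eqVneq => [->|_] /=; first by rewrite yF.
  by case: eqVneq => [->|_] //=; rewrite xF.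
have [||B hB [e1 e2]] := IH _ BM.
- by rewrite e.
- rewrite -ltnS (leq_trans _ hk) // ltnS [ltnRHS](cardsD1 x) !inE x1 x2 xF /=.
  rewrite add1n ltnS; apply/subset_leq_card/subsetP => z; rewrite !inE.
  case/and3P=> z1 /orP[/eqP zy|/andP[-> ->]] zF; last by rewrite z1 zF.
  by rewrite zy y1 in z1.
by exists B => //; rewrite e1 e.
Qed.

Lemma deletion_exchange M F : basis_exchange (deletion_bases M F).
Proof.
move=> _ _ /imsetP[B1 + ->] /imsetP[B2 + ->].
rewrite !inE => /andP[h1 /eqP r1] /andP[h2 /eqP r2] x.
have [B h [eD eI]] := deletion_align h1 h2 r1 r2.
rewrite -eD => xB.
have x1 : x \in B1 by move: xB; rewrite !inE => /andP[_ /andP[]].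
have xF : x \notin F by move: xB; rewrite !inE => /andP[_ /andP[]].
have xB' : x \notin B by move: xB; rewrite !inE xF x1 /= andbT.
have [|y] := bases_exchange h1 h (x := x); first by rewrite !inE xB'.
rewrite !inE => /andP[y1 yB] BM.
have yF : y \notin F.
  apply: contra y1 => yF.
  by have: y \in B :&: F by [rewrite inE yB]; rewrite eI inE => /andP[].
exists y; first by rewrite !inE (negPf y1) yF yB.
have e : (y |: (B1 :\ x)) :\: F = y |: ((B1 :\: F) :\ x).
  apply/setP => z; rewrite !inE.
  by case: eqVneq => [->|_] /=; [rewrite yF | case: (z == x); rewrite ?andbF].
apply/imsetP; exists (y |: (B1 :\ x)); rewrite ?e //.
by rewrite inE BM /= e card_exchange ?r1 // !inE ?xF ?(negPf y1) ?andbF.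
Qed.

Definition deletion M F : matroid :=
  Matroid (@deletion_ground M F) (deletion_neq0 M F) (@deletion_exchange M F).

(* Whitney's form of the characteristic polynomial. *)
Definition matroid_char_poly M : {poly int} :=
  \sum_(A in powerset (ground M)) (-1) ^+ #|A| *: 'X^(rk M - rank M A).

(* Division is exact when [rk M > 0]. *)
Definition reduced_char_poly M : {poly int} := matroid_char_poly M %/ ('X - 1).

End Matroid.

Section Configuration.
Variables (K : fieldType) (n : nat) (W : {vspace 'rV[K]_n}).
Implicit Type B : {set 'I_n}.

Definition coord_proj B (w : subvs_of W) : {ffun {i : 'I_n | i \in B} -> K} :=
  [ffun i => vsval w 0 (val i)].

Definition config_bases : {set {set 'I_n}} :=
  [set B | `[< bijective (@coord_proj B) >]].

Lemma config_basisP B : reflect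
  ((forall w, w \in W -> (forall i, i \in B -> w 0 i = 0) -> w = 0) /\
   (forall x : 'I_n -> K, exists2 w, w \in W & forall i, i \in B -> w 0 i = x i))
  (B \in config_bases).
Proof.
rewrite inE; apply: (iffP (asboolP _)) => [[g gK Kg]|[inj surj]].
  split=> [w wW w0|x].
    have e : vsproj W w = 0.
      apply: (can_inj gK); apply/ffunP => i.
      by rewrite !ffunE vsprojK // w0 ?(valP i) //= mxE.
    by rewrite -(vsprojK wW) e linear0.
  exists (vsval (g [ffun i => x (val i)])); first exact: subvsP.
  move=> i iB; have /ffunP/(_ (exist _ i iB)) := Kg [ffun i => x (val i)].
  by rewrite !ffunE.
have ex (f : {ffun {i : 'I_n | i \in B} -> K}) :
    exists w : subvs_of W, coord_proj B w = f.
  have [w wW e] := surj (fun i => if insub i is Some j then f j else 0).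
  exists (vsproj W w); apply/ffunP => i.
  by rewrite ffunE vsprojK // e ?(valP i) // valK.
have [g gP] := choice ex; exists g => // w.
apply/val_inj/eqP; rewrite -subr_eq0; apply/eqP; apply: inj.
  by rewrite memvB ?subvsP.
move=> i iB; have /ffunP/(_ (exist _ i iB)) := gP (coord_proj B w).
by rewrite !ffunE !mxE /= => ->; rewrite subrr.
Qed.

Lemma config_ground B : B \in config_bases -> B \subset [set: 'I_n].
Proof. by rewrite subsetT. Qed.

Lemma config_neq0 : config_bases != set0.
Proof.
pose P B := `[< forall w, w \in W -> (forall i, i \in B -> w 0 i = 0) -> w = 0 >].
have PT : P setT.
  by apply/asboolP => w _ w0; apply/rowP => i; rewrite w0 ?mxE ?inE.
have [B /minsetP[/asboolP PB minB] _] := minset_exists PT.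
apply/set0Pn; exists B; apply/config_basisP; split=> // x.
have ex i : exists w, i \in B ->
    [/\ w \in W, w 0 i = 1 & forall j, j \in B -> j != i -> w 0 j = 0].
  have [iB|_] := boolP (i \in B); last by exists 0.
  have [/minB|/asboolP/existsNP[w]] := boolP (P (B :\ i)).
    by move=> /(_ (subD1set _ _))/setP/(_ i); rewrite !inE eqxx iB.
  move=> /not_implyP[wW /not_implyP[w0 wN0]].
  have wi : w 0 i != 0.
    apply/eqP => wi; apply: wN0; apply: PB => // j jB.
    by have [->//|ji] := eqVneq j i; apply: w0; rewrite !inE ji.
  exists ((w 0 i)^-1 *: w) => _; split; first exact: memvZ.
    by rewrite mxE mulVf.
  by move=> j jB ji; rewrite mxE [w 0 j]w0 ?mulr0 // in_setD1 ji.
have [e eP] := choice ex.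
exists (\sum_(i in B) x i *: e i).
  by apply: memv_suml => i /eP[eW _ _]; apply: memvZ.
move=> j jB; rewrite summxE (bigD1 j) //= big1 => [|i /andP[iB ij]].
  by rewrite addr0 mxE; case: (eP _ jB) => _ -> _; rewrite mulr1.
by rewrite mxE; case: (eP _ iB) => _ _ ->; rewrite ?mulr0 // eq_sym.
Qed.

Lemma config_exchange : basis_exchange config_bases.
Proof.
move=> B1 B2 /config_basisP[inj1 surj1] /config_basisP[inj2 _] x.
rewrite !inE => /andP[x2 x1].
have [w wW we] := surj1 (fun i => (i == x)%:R).
have [y yB2 wy] : exists2 y, y \in B2 & w 0 y != 0.
  apply/exists_inP/contraT => /exists_inPn w0; have /rowP/(_ x) : w = 0.
    by apply: inj2 => // i /w0; rewrite negbK => /eqP.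
  by rewrite mxE we // eqxx => /eqP; rewrite oner_eq0.
have yx : y != x by apply: contraNneq x2 => <-.
have y1 : y \notin B1.
  by apply: contra wy => y1; rewrite we // (negPf yx).
exists y; first by rewrite !inE y1.
apply/config_basisP; split=> [u uW u0|t].
  have uE : u = u 0 x *: w.
    apply/eqP; rewrite -subr_eq0; apply/eqP; apply: inj1.
      by rewrite memvB // memvZ.
    move=> i i1; rewrite !mxE we //.
    have [->|ix] := eqVneq i x; first by rewrite mulr1 subrr.
    by rewrite mulr0 subr0 u0 // !inE ix i1 orbT.
  have /eqP : u 0 y = 0 by rewrite u0 // !inE eqxx.
  by rewrite uE mxE mulf_eq0 (negPf wy) orbF => /eqP ->; rewrite scale0r.
have [u uW ue] := surj1 (fun i => if i == x then 0 else t i).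
exists (u + ((t y - u 0 y) / w 0 y) *: w).
  by rewrite memvD // memvZ.
move=> i; rewrite !inE => /orP[/eqP->|/andP[ix i1]].
  by rewrite !mxE divfK // addrC subrK.
by rewrite !mxE [u 0 i]ue // [w 0 i]we // (negPf ix) mulr0 addr0.
Qed.

Definition config_matroid : matroid 'I_n :=
  Matroid config_ground config_neq0 config_exchange.

End Configuration.

(* Varieties over an algebraically closed field are taken to be quasi-projective
   and given by their closed points, as locally closed subsets of products of
   projective spaces; these generate the Grothendieck ring of all varieties.

   A product of [nblocks] projective spaces, with all homogeneous coordinates
   listed in one family; [block i] is the factor to which coordinate [i]
   belongs. *)
Record multiproj := MultiProj {
  nvars : nat;
  nblocks : nat;
  block : 'I_nvars -> 'I_nblocks }.

Section MultiProj.
Variables (K : closedFieldType) (A : multiproj).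
Local Notation vec := ('I_(nvars A) -> K).
Local Notation pol := {mpoly K[nvars A]}.

Definition is_point (v : vec) : Prop :=
  forall c, exists2 i, block i = c & v i != 0.

Definition same_point (v v' : vec) : Prop :=
  exists2 t : 'I_(nblocks A) -> K,
    forall c, t c != 0 & forall i, v' i = t (block i) * v i.

Definition has_multidegree (d : 'I_(nblocks A) -> nat) (p : pol) : Prop :=
  forall m, m \in msupp p -> forall c, (\sum_(i | block i == c) m i)%N = d c.

Definition multihomogeneous (p : pol) : Prop := exists d, has_multidegree d p.

(* Point sets are predicates on vectors of homogeneous coordinates. *)
Definition closed_set (Z : vec -> Prop) : Prop :=
  exists2 S : pol -> Prop,
    forall p, S p -> multihomogeneous p &
    forall v, Z v <-> is_point v /\ forall p, S p -> p.@[v] = 0.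

Definition locally_closed (X : vec -> Prop) : Prop :=
  exists Z1 Z2, [/\ closed_set Z1, closed_set Z2 &
    forall v, X v <-> Z1 v /\ ~ Z2 v].

Definition closed_in (X Z : vec -> Prop) : Prop :=
  exists2 Y, closed_set Y & forall v, Z v <-> X v /\ Y v.

End MultiProj.

Record variety (K : closedFieldType) := Variety {
  ambient : multiproj;
  points : ('I_(nvars ambient) -> K) -> Prop;
  points_locally_closed : locally_closed points }.
Arguments points {K} X v : rename.

Section Morphisms.
Variables (K : closedFieldType).

(* Near each point of X, the map is given in each factor of the target by forms
   of a common multidegree; the basic open sets h <> 0 form a basis of the
   topology. *)
Definition regular_map (X Y : variety K)
    (f : ('I_(nvars (ambient X)) -> K) -> ('I_(nvars (ambient Y)) -> K)) : Prop :=
  (forall v, points X v -> points Y (f v)) /\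
  forall v, points X v ->
  exists (h : {mpoly K[nvars (ambient X)]})
         (p : 'I_(nvars (ambient Y)) -> {mpoly K[nvars (ambient X)]})
         (d : 'I_(nblocks (ambient Y)) -> 'I_(nblocks (ambient X)) -> nat),
  [/\ multihomogeneous h, h.@[v] != 0,
      forall j, has_multidegree (d (block j)) (p j) &
      forall v', points X v' -> h.@[v'] != 0 ->
        is_point (fun j => (p j).@[v']) /\
        same_point (fun j => (p j).@[v']) (f v')].

Definition isomorphic (X Y : variety K) : Prop :=
  exists f g, [/\ @regular_map X Y f, @regular_map Y X g,
    forall v, points X v -> same_point (g (f v)) v &
    forall w, points Y w -> same_point (f (g w)) w].

End Morphisms.

Definition mp_prod (A1 A2 : multiproj) : multiproj :=
  @MultiProj (nvars A1 + nvars A2) (nblocks A1 + nblocks A2)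
    (fun i => match split i with
              | inl j => lshift (nblocks A2) (block j)
              | inr j => rshift (nblocks A1) (block j)
              end).

Section Product.
Variables (K : closedFieldType) (A1 A2 : multiproj).
Local Notation A := (mp_prod A1 A2).
Implicit Type v : 'I_(nvars A) -> K.

Definition fst_coords v (i : 'I_(nvars A1)) : K := v (lshift (nvars A2) i).
Definition snd_coords v (i : 'I_(nvars A2)) : K := v (rshift (nvars A1) i).

Definition monom_l (m : 'X_{1..nvars A1}) : 'X_{1..nvars A} :=
  [multinom match split i with inl j => m j | inr _ => 0 end | i < nvars A].
Definition monom_r (m : 'X_{1..nvars A2}) : 'X_{1..nvars A} :=
  [multinom match split i with inl _ => 0 | inr j => m j end | i < nvars A].

Definition poly_l (p : {mpoly K[nvars A1]}) : {mpoly K[nvars A]} :=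
  \sum_(m <- msupp p) p@_m *: 'X_[monom_l m].
Definition poly_r (p : {mpoly K[nvars A2]}) : {mpoly K[nvars A]} :=
  \sum_(m <- msupp p) p@_m *: 'X_[monom_r m].

Lemma splitl (i : 'I_(nvars A1)) : split (lshift (nvars A2) i) = inl i.
Proof. exact: (unsplitK (inl i)). Qed.
Lemma splitr (i : 'I_(nvars A2)) : split (rshift (nvars A1) i) = inr i.
Proof. exact: (unsplitK (inr i)). Qed.

Lemma block_l i : @block A (lshift _ i) = lshift _ (@block A1 i).
Proof. by rewrite /= splitl. Qed.
Lemma block_r i : @block A (rshift _ i) = rshift _ (@block A2 i).
Proof. by rewrite /= splitr. Qed.

Lemma poly_lE p v : (poly_l p).@[v] = p.@[fst_coords v].
Proof.
rewrite raddf_sum [RHS]mevalE; apply: eq_bigr => m _ /=.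
rewrite mevalZ mevalX big_split_ord /= [X in _ * (_ * X)]big1 ?mulr1 => [|i _].
  by congr (_ * _); apply: eq_bigr => i _; rewrite mnmE splitl.
by rewrite mnmE splitr expr0.
Qed.

Lemma poly_rE p v : (poly_r p).@[v] = p.@[snd_coords v].
Proof.
rewrite raddf_sum [RHS]mevalE; apply: eq_bigr => m _ /=.
rewrite mevalZ mevalX big_split_ord /= [X in _ * (X * _)]big1 ?mul1r => [|i _].
  by congr (_ * _); apply: eq_bigr => i _; rewrite mnmE splitr.
by rewrite mnmE splitl expr0.
Qed.

Lemma is_point_prod v :
  is_point v <-> is_point (fst_coords v) /\ is_point (snd_coords v).
Proof.
split=> [h|[h1 h2] c].
  split=> c.
    case: (h (lshift _ c)) => i; case: (split_ordP i) => j -> /=.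
      by rewrite splitl => /lshift_inj<- vj; exists j.
    by rewrite splitr => /eqP; rewrite eq_rlshift.
  case: (h (rshift _ c)) => i; case: (split_ordP i) => j -> /=.
    by rewrite splitl => /eqP; rewrite eq_lrshift.
  by rewrite splitr => /rshift_inj<- vj; exists j.
case: (split_ordP c) => j ->.
  by have [i <- vi] := h1 j; exists (lshift _ i); rewrite // block_l.
by have [i <- vi] := h2 j; exists (rshift _ i); rewrite // block_r.
Qed.

End Product.

Section MultidegreeLemmas.
Variables (K : closedFieldType).

Lemma has_multidegreeX (A : multiproj) i :
  has_multidegree (fun c => @block A i == c) ('X_i : {mpoly K[nvars A]}).
Proof.
move=> m; rewrite msuppX inE => /eqP-> c; rewrite big_mkcond (bigD1 i) //=.
rewrite mnm1E eqxx big1 ?addn0 => [|j ji]; first by case: eqP.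
by rewrite mnm1E [i == j]eq_sym (negPf ji) if_same.
Qed.

Lemma has_multidegreeM (A : multiproj) d e (p q : {mpoly K[nvars A]}) :
  has_multidegree d p -> has_multidegree e q ->
  has_multidegree (fun c => d c + e c)%N (p * q).
Proof.
move=> hp hq m /msuppM_le/allpairsP[[m1 m2] /= [h1 h2 ->]] c.
rewrite -(hp _ h1 c) -(hq _ h2 c) -big_split /=.
by apply: eq_bigr => i _; rewrite mnmDE.
Qed.

Lemma has_multidegree_sum (A : multiproj) d k (a : 'I_k -> K)
    (p : 'I_k -> {mpoly K[nvars A]}) :
  (forall i, has_multidegree d (p i)) ->
  has_multidegree d (\sum_i a i *: p i).
Proof.
move=> hp m /msupp_sum_le/flattenP[_ /mapP[i _ ->]] /msuppZ_le; exact: hp.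
Qed.

Lemma multihomogeneousM (A : multiproj) (p q : {mpoly K[nvars A]}) :
  multihomogeneous p -> multihomogeneous q -> multihomogeneous (p * q).
Proof. by move=> [d hp] [e hq]; eexists; apply: has_multidegreeM hp hq. Qed.

Lemma multihomogeneous_l (A1 A2 : multiproj) (p : {mpoly K[nvars A1]}) :
  multihomogeneous p -> multihomogeneous (A := mp_prod A1 A2) (poly_l A2 p).
Proof.
move=> [d hp]; exists (fun c => match split c with inl j => d j | inr _ => 0 end)%N.
move=> m /msupp_sum_le /flattenP[_ /mapP[m1 m1p ->] mm] c.
have -> : m = @monom_l A1 A2 m1.
  by move/msuppZ_le: mm; rewrite msuppX inE => /eqP.
rewrite filter_predT in m1p.
rewrite big_mkcond big_split_ord /= [X in (_ + X)%N]big1 ?addn0 => [|i _]; last first.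
  by rewrite mnmE !splitr; case: ifP.
case: (split_ordP c) => j ->.
  rewrite -(hp _ m1p j) [RHS]big_mkcond /=.
  by apply: eq_bigr => i _; rewrite mnmE !splitl (inj_eq (@lshift_inj _ _)).
by apply: big1 => i _; rewrite splitl eq_lrshift.
Qed.

Lemma multihomogeneous_r (A1 A2 : multiproj) (p : {mpoly K[nvars A2]}) :
  multihomogeneous p -> multihomogeneous (A := mp_prod A1 A2) (poly_r A1 p).
Proof.
move=> [d hp]; exists (fun c => match split c with inl _ => 0 | inr j => d j end)%N.
move=> m /msupp_sum_le /flattenP[_ /mapP[m1 m1p ->] mm] c.
have -> : m = @monom_r A1 A2 m1.
  by move/msuppZ_le: mm; rewrite msuppX inE => /eqP.
rewrite filter_predT in m1p.
rewrite big_mkcond big_split_ord /= [X in (X + _)%N]big1 ?add0n => [|i _]; last first.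
  by rewrite mnmE !splitl; case: ifP.
case: (split_ordP c) => j ->.
  by apply: big1 => i _; rewrite splitr eq_rlshift.
rewrite -(hp _ m1p j) [RHS]big_mkcond /=.
by apply: eq_bigr => i _; rewrite mnmE !splitr (inj_eq (@rshift_inj _ _)).
Qed.

Lemma prod_locally_closed (X Y : variety K) :
  locally_closed (A := mp_prod (ambient X) (ambient Y))
    (fun v => points X (fst_coords v) /\ points Y (snd_coords v)).
Proof.
have [Z1 [Z2 [[S1 hS1 S1P] [S2 hS2 S2P] XE]]] := points_locally_closed X.
have [T1 [T2 [[U1 hU1 U1P] [U2 hU2 U2P] YE]]] := points_locally_closed Y.
set A := mp_prod _ _.
pose I (p : {mpoly K[nvars A]}) :=
  (exists2 q, S1 q & p = poly_l _ q) \/ (exists2 q, U1 q & p = poly_r _ q).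
pose J (p : {mpoly K[nvars A]}) :=
  exists q r, [/\ S2 q, U2 r & p = poly_l _ q * poly_r _ r].
exists (fun v => is_point (A := A) v /\ forall p, I p -> p.@[v] = 0).
exists (fun v => is_point (A := A) v /\ forall p, J p -> p.@[v] = 0).
split.
- exists I => // _ [[q /hS1 hq ->]|[q /hU1 hq ->]].
    exact: multihomogeneous_l.
  exact: multihomogeneous_r.
- exists J => // _ [q [r [/hS2 hq /hU2 hr ->]]]; apply: multihomogeneousM.
    exact: multihomogeneous_l.
  exact: multihomogeneous_r.
move=> v; split.
  move=> [/XE[/S1P[v1 h1] n1] /YE[/U1P[v2 h2] n2]].
  have vv : is_point (A := A) v by apply/is_point_prod.
  split.
    split=> // _ [[q /h1 hq ->]|[q /h2 hq ->]]; first by rewrite poly_lE.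
    by rewrite poly_rE.
  move=> [_ hJ]; have /existsNP[q /not_implyP[Sq /eqP q0]] :
      ~ (forall q, S2 q -> q.@[fst_coords v] = 0).
    by move=> h; apply: n1; apply/S2P.
  apply: n2; apply/U2P; split=> // r Ur.
  have /eqP : (poly_l _ q * poly_r _ r).@[v] = 0 by apply: hJ; exists q, r.
  by rewrite mevalM poly_lE poly_rE mulf_eq0 (negPf q0) => /eqP.
move=> [[/is_point_prod[v1 v2] hI] nJ]; split.
  apply/XE; split.
    by apply/S1P; split=> // q Sq; rewrite -poly_lE; apply: hI; left; exists q.
  move=> /S2P[_ h]; apply: nJ; split; first exact/is_point_prod.
  by move=> _ [q [r [Sq _ ->]]]; rewrite mevalM poly_lE h // mul0r.
apply/YE; split.
  by apply/U1P; split=> // q Sq; rewrite -poly_rE; apply: hI; right; exists q.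
move=> /U2P[_ h]; apply: nJ; split; first exact/is_point_prod.
by move=> _ [q [r [_ Ur ->]]]; rewrite mevalM poly_rE h // mulr0.
Qed.

Definition variety_prod (X Y : variety K) : variety K :=
  Variety (prod_locally_closed X Y).

End MultidegreeLemmas.

(* The space of lines of K^n, of dimension n - 1. *)
Definition proj_space (n : nat) : multiproj :=
  @MultiProj n 1 (fun=> ord0).

Section Basic.
Variable K : closedFieldType.

Lemma multihomogeneous1 (A : multiproj) : multihomogeneous (1 : {mpoly K[nvars A]}).
Proof.
by exists (fun=> 0%N) => m; rewrite msupp1 inE => /eqP-> c; apply: big1 => i _; rewrite mnm0E.
Qed.

Lemma closed_set0 (A : multiproj) : closed_set (A := A) (K := K) (fun=> False).
Proof.
exists (fun p => p = 1) => [_ ->|v]; first exact: multihomogeneous1.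
by split=> // -[_ /(_ 1 erefl)/eqP]; rewrite meval1 oner_eq0.
Qed.

Lemma closed_locally_closed (A : multiproj) (Z : ('I_(nvars A) -> K) -> Prop) :
  closed_set Z -> locally_closed Z.
Proof.
move=> hZ; exists Z, (fun=> False); split=> //; first exact: closed_set0.
by move=> v; split=> [Zv|[]//]; split.
Qed.

Lemma point_locally_closed :
  locally_closed (K := K) (A := proj_space 1) (is_point (A := proj_space 1)).
Proof.
by apply: closed_locally_closed; exists (fun=> False) => // v; split=> [|[]].
Qed.

Definition point_variety : variety K := Variety point_locally_closed.

(* The affine line is the complement of the point x_0 = 0 in the projective
   line with homogeneous coordinates x_0, x_1. *)
Lemma affine_line_locally_closed :
  locally_closed (K := K) (A := proj_space 2)
    (fun v => is_point (A := proj_space 2) v /\ v ord0 != 0).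
Proof.
exists (is_point (A := proj_space 2)).
exists (fun v => is_point (A := proj_space 2) v /\ v ord0 = 0); split.
- by exists (fun=> False) => // v; split=> [|[]].
- exists (fun p => p = 'X_ord0) => [_ ->|v].
    by eexists; apply: has_multidegreeX.
  by split=> -[pv h]; split=> //; [move=> _ ->; rewrite mevalXU | rewrite -(h _ erefl) mevalXU].
by move=> v; split=> -[pv h]; split=> //; [case=> _ /eqP; apply/negP | apply/eqP => v0; apply: h].
Qed.

Definition affine_line : variety K := Variety affine_line_locally_closed.

End Basic.

HB.instance Definition _ (K : closedFieldType) := gen_eqMixin (variety K).
HB.instance Definition _ (K : closedFieldType) := gen_choiceMixin (variety K).

Section Grothendieck.
Variable K : closedFieldType.

(* The polynomial ring over the integers with one variable for each variety. *)
Definition free_ring : Type := monalg.malg (monalg.cmonom (variety K)) int.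
HB.instance Definition _ := GRing.ComNzRing.on free_ring.

Definition free_gen (X : variety K) : free_ring :=
  monalg.mkmalgU (monalg.ucm X) (1 : int).

Inductive scissor_relation : free_ring -> Prop :=
| rel_iso X Y : isomorphic X Y -> scissor_relation (free_gen X - free_gen Y)
| rel_cut (A : multiproj) (X Z U : ('I_(nvars A) -> K) -> Prop)
    (hX : locally_closed X) (hZ : locally_closed Z) (hU : locally_closed U) :
    closed_in X Z -> (forall v, U v <-> X v /\ ~ Z v) ->
    scissor_relation (free_gen (Variety hX) -
                      (free_gen (Variety hZ) + free_gen (Variety hU)))
| rel_prod X Y :
    scissor_relation (free_gen (variety_prod X Y) - free_gen X * free_gen Y)
| rel_point : scissor_relation (free_gen (point_variety K) - 1).

Inductive scissor_ideal : free_ring -> Prop :=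
| ideal_rel x : scissor_relation x -> scissor_ideal x
| ideal_0 : scissor_ideal 0
| ideal_D x y : scissor_ideal x -> scissor_ideal y -> scissor_ideal (x + y)
| ideal_M a x : scissor_ideal x -> scissor_ideal (a * x).

Definition K0_equiv (x y : free_ring) : bool := `[< scissor_ideal (x - y) >].

Lemma K0_equivP : equiv_class_of K0_equiv.
Proof.
have idN x : scissor_ideal x -> scissor_ideal (- x).
  by rewrite -mulN1r; apply: ideal_M.
split=> [x|x y|y x z].
- by apply/asboolP; rewrite subrr; apply: ideal_0.
- by apply/asbool_equiv_eq; split=> /idN; rewrite opprB.
move=> /asboolP h1 /asboolP h2; apply/asboolP.
by rewrite -[x](subrK y) -addrA; apply: ideal_D.
Qed.

Canonical K0_equiv_equiv := EquivRelPack K0_equivP.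
Canonical K0_encModRel := defaultEncModRel K0_equiv.

(* The library quotient [{ideal_quot _}] asks for a proof that 1 is not in the
   ideal, which is a theorem about varieties; the quotient is therefore built
   here as a possibly trivial ring. *)
Definition K0 : Type := {eq_quot K0_equiv}.
HB.instance Definition _ : EqQuotient free_ring K0_equiv K0 := EqQuotient.on K0.
HB.instance Definition _ := Choice.on K0.

Lemma K0_eqP (x y : free_ring) :
  reflect (scissor_ideal (x - y)) (\pi_K0 x == \pi_K0 y).
Proof. by rewrite piE; apply: asboolP. Qed.

Definition K0_zero : K0 := \pi_K0 0.
Definition K0_one : K0 := \pi_K0 1.
Definition K0_opp (x : K0) : K0 := \pi_K0 (- repr x).
Definition K0_add (x y : K0) : K0 := \pi_K0 (repr x + repr y).
Definition K0_mul (x y : K0) : K0 := \pi_K0 (repr x * repr y).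

Lemma K0_repr x : scissor_ideal (repr (\pi_K0 x) - x).
Proof. by apply/K0_eqP; rewrite reprK. Qed.

Lemma K0_pi_opp x : K0_opp (\pi_K0 x) = \pi_K0 (- x).
Proof.
apply/eqP/K0_eqP; rewrite -opprD -mulN1r; apply: ideal_M; exact: K0_repr.
Qed.

Lemma K0_pi_add x y : K0_add (\pi_K0 x) (\pi_K0 y) = \pi_K0 (x + y).
Proof.
apply/eqP/K0_eqP; rewrite opprD addrACA; apply: ideal_D; exact: K0_repr.
Qed.

Lemma K0_pi_mul x y : K0_mul (\pi_K0 x) (\pi_K0 y) = \pi_K0 (x * y).
Proof.
apply/eqP/K0_eqP; set x' := repr _; set y' := repr _.
have -> : x' * y' - x * y = y' * (x' - x) + x * (y' - y).
  by rewrite !mulrBr [y' * x]mulrC addrA subrK mulrC.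
by apply: ideal_D; apply: ideal_M; apply: K0_repr.
Qed.

Lemma K0_ind (P : K0 -> Prop) : (forall x, P (\pi_K0 x)) -> forall x, P x.
Proof. by move=> h x; rewrite -[x]reprK. Qed.

Lemma K0_addA : associative K0_add.
Proof. by do 3!elim/K0_ind=> ?; rewrite !K0_pi_add addrA. Qed.
Lemma K0_addC : commutative K0_add.
Proof. by do 2!elim/K0_ind=> ?; rewrite !K0_pi_add addrC. Qed.
Lemma K0_add0 : left_id K0_zero K0_add.
Proof. by elim/K0_ind=> ?; rewrite !K0_pi_add add0r. Qed.
Lemma K0_addN : left_inverse K0_zero K0_opp K0_add.
Proof. by elim/K0_ind=> ?; rewrite K0_pi_opp !K0_pi_add addNr. Qed.
HB.instance Definition _ :=
  GRing.isZmodule.Build K0 K0_addA K0_addC K0_add0 K0_addN.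

Lemma K0_mulA : associative K0_mul.
Proof. by do 3!elim/K0_ind=> ?; rewrite !K0_pi_mul mulrA. Qed.
Lemma K0_mulC : commutative K0_mul.
Proof. by do 2!elim/K0_ind=> ?; rewrite !K0_pi_mul mulrC. Qed.
Lemma K0_mul1 : left_id K0_one K0_mul.
Proof. by elim/K0_ind=> ?; rewrite !K0_pi_mul mul1r. Qed.
Lemma K0_mulDl : left_distributive K0_mul K0_add.
Proof.
by do 3!elim/K0_ind=> ?; rewrite !(K0_pi_mul, K0_pi_add) mulrDl.
Qed.
HB.instance Definition _ :=
  GRing.Zmodule_isComPzRing.Build K0 K0_mulA K0_mulC K0_mul1 K0_mulDl.

Definition K0_class (X : variety K) : K0 := \pi_K0 (free_gen X).

Definition lefschetz : K0 := K0_class (affine_line K).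

(* [horner] is not available over a ring not known to be nontrivial. *)
Definition eval_int (p : {poly int}) (x : K0) : K0 :=
  \sum_(i < size p) x ^+ i *~ p`_i.

End Grothendieck.

Section Lambda.
Variables (K : closedFieldType) (n : nat) (W : {vspace 'rV[K]_n}).

Local Notation PVPV := (mp_prod (proj_space n) (proj_space n)).

(* The second coordinates are the beta_i. The last condition is the vanishing of
   the linear form \sum_i beta_i w_i y_i on W. *)
Definition Lambda_points (v : 'I_(nvars PVPV) -> K) : Prop :=
  let w := fst_coords v in let beta := snd_coords v in
  [/\ is_point v, \row_i w i \in W &
      forall u : 'rV[K]_n, u \in W -> \sum_i beta i * w i * u 0 i = 0].

Lemma Lambda_locally_closed : locally_closed Lambda_points.
Proof.
apply: closed_locally_closed.
pose D := (\1 - projv W)%VF.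
have DP w : (w \in W) = (D w == 0).
  rewrite add_lfunE opp_lfunE id_lfunE subr_eq0 eq_sym.
  apply/idP/eqP => [/projv_id//|<-]; exact: memv_proj.
pose X1 i : {mpoly K[nvars PVPV]} := 'X_(lshift n i).
pose X2 i : {mpoly K[nvars PVPV]} := 'X_(rshift n i).
pose L j : {mpoly K[nvars PVPV]} := \sum_(i < n) D (delta_mx 0 i) 0 j *: X1 i.
pose Q (u : 'rV[K]_n) : {mpoly K[nvars PVPV]} :=
  \sum_(i < n) u 0 i *: (X2 i * X1 i).
exists (fun p => (exists j, p = L j) \/ exists2 u, u \in W & p = Q u).
  move=> _ [[j ->]|[u _ ->]].
    exists (fun c : 'I_(1 + 1) => nat_of_bool (lshift 1 ord0 == c)); apply: has_multidegree_sum => i.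
    by have := @has_multidegreeX _ PVPV (lshift n i); rewrite block_l.
  exists (fun c : 'I_(1 + 1) => (rshift 1 ord0 == c) + (lshift 1 ord0 == c))%N.
  apply: has_multidegree_sum => i; apply: has_multidegreeM.
    by have := @has_multidegreeX _ PVPV (rshift n i); rewrite block_r.
  by have := @has_multidegreeX _ PVPV (lshift n i); rewrite block_l.
move=> v; have LE j : (L j).@[v] = D (\row_i fst_coords v i) 0 j.
  rewrite [\row_i _](row_sum_delta) /L raddf_sum [in RHS]linear_sum summxE /=.
  by apply: eq_bigr => i _; rewrite mevalZ mevalXU [in RHS]linearZ !mxE mulrC.
have QE u : (Q u).@[v] = \sum_i snd_coords v i * fst_coords v i * u 0 i.
  rewrite /Q raddf_sum; apply: eq_bigr => i _.
  by rewrite /= mevalZ mevalM !mevalXU mulrC.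
split=> [[pv wW h]|[pv h]].
  split=> // _ [[j ->]|[u uW ->]]; last by rewrite QE h.
  by move: wW; rewrite LE DP => /eqP->; rewrite mxE.
split=> // [|u uW]; last by rewrite -QE; apply: h; right; exists u.
rewrite DP; apply/eqP/rowP => j; rewrite -LE mxE.
by apply: h; left; exists j.
Qed.

Definition Lambda : variety K := Variety Lambda_locally_closed.

End Lambda.

(* Main.v *)
Require Import Defs.
From mathcomp Require Import all_boot all_order all_algebra.
From mathcomp Require Import boolp reals complex.
From mathcomp Require Import mpoly.

Set Implicit Arguments.
Unset Strict Implicit.
Unset Printing Implicit Defensive.

Import GRing.Theory.
Local Open Scope ring_scope.
Local Open Scope quotient_scope.

(* Cut Lambda according to the zero set F of w, which is a flat other than E.
   Over the stratum of F the equations in beta become the constant linear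
   equations sum_(i \notin F) b_i y_i = 0 on W after the substitution
   b_i = beta_i w_i for i outside F, so the stratum is the product of
   S_F = {w in P(W) : w_i = 0 iff i in F} with a projective space of dimension
   n - rank(M \ F) - 1.  The class of S_F is computed by inclusion-exclusion on
   the subspaces w_A = 0 with F \subset A; Whitney's formula together with
   (t^k - 1) / (t - 1) = 1 + ... + t^(k-1) identifies the result with the
   reduced characteristic polynomial of M / F.  The whole computation is
   projective because L - 1 may be a zero divisor in K_0. *)

(** * Rank in contractions and deletions *)

Section MatroidRank.
Variable E : finType.
Implicit Type M : matroid E.
Implicit Types (A B F : {set E}).

Lemma rk_card M B : B \in bases M -> rk M = #|B|.
Proof.
move=> BM; have [B' B'M e] := rank_attained M (ground M).
by rewrite /rk -e (setIidPr (bases_ground B'M)) (bases_card B'M BM).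
Qed.

(* Take [B] with the right trace on [F] and the largest trace on [F :|: A];
   exchanges towards a basis attaining [rank M (F :|: A)] leave the trace on
   [F :|: A] unchanged until one enlarges it. *)
Lemma rank_attained_chain M F A : exists2 B, B \in bases M &
  #|F :&: B| = rank M F /\ #|(F :|: A) :&: B| = rank M (F :|: A).
Proof.
set G := F :|: A.
have [B2 h2 e2] := rank_attained M G.
have [B0 h0 e0] := rank_attained M F.
(* Lexicographic induction: an exchange lowers the deficit on [G] or, at equal deficit, the distance
   [#|B0 :\: B2|]. *)
have [m] := ubnP (rank M G - #|G :&: B0|).
have [k] := ubnP #|B0 :\: B2|.
elim: m k B0 h0 e0 => // m IHm; elim=> // k IHk B h e hk hm.
have [eG|neG] := eqVneq #|G :&: B| (rank M G); first by exists B.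
have ltG : (#|G :&: B| < #|G :&: B2|)%N by rewrite ltn_neqAle e2 neG rank_max.
(* Otherwise [B :\: G] lies in [B2], and since bases have equal size the trace of [B] on [G] is at
   least as large as that of [B2]. *)
have [x] : exists x, x \in (B :\: G) :\: B2.
  apply/set0Pn; rewrite setD_eq0; apply: contraTN ltG => sub; rewrite -leqNgt.
  have: (#|B :\: G| <= #|B2 :\: G|)%N.
    by apply/subset_leq_card/subsetP => z zB; rewrite inE (subsetP sub) // andbT; case/setDP: zB.
  rewrite -(leq_add2l #|G :&: B|) [X in (X <= _)%N -> _]addnC setIC addnC cardsID (bases_card h h2).
  by rewrite -(cardsID G B2) [B2 :&: G]setIC leq_add2r setIC.
rewrite !inE => /andP[x2 /andP[/norP[xF xA] xB]].
have [|y] := bases_exchange h h2 (x := x); first by rewrite !inE x2.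
rewrite !inE => /andP[yB y2] BM.
have eI (C : {set E}) : x \notin C ->
    C :&: (y |: (B :\ x)) = if y \in C then y |: (C :&: B) else C :&: B.
  move=> xC; apply/setP => z; rewrite !inE.
  case: ifP => yC; rewrite !inE; (case: eqVneq => [->|_] /=; last by
    case: eqVneq => [->|_] //=; rewrite (negPf xC)).
    by rewrite yC.
  by rewrite yC.
have eF : #|F :&: (y |: (B :\ x))| = rank M F.
  apply/eqP; rewrite eqn_leq rank_max //= -e subset_leq_card // eI //.
  by case: ifP => _ //; apply: subsetUr.
have xG : x \notin G by rewrite !inE negb_or xF.
have [yG|yG] := boolP (y \in G).
  apply: (IHm #|(y |: (B :\ x)) :\: B2|.+1 (y |: (B :\ x))) => //.
  rewrite -ltnS (leq_trans _ hm) // ltnS eI // yG cardsU1 !inE (negPf yB) andbF.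
  by rewrite add1n subnSK // -?e2.
apply: (IHk (y |: (B :\ x))) => //; last by rewrite eI // (negPf yG).
rewrite -ltnS (leq_trans _ hk) // ltnS [ltnRHS](cardsD1 x) !inE x2 xB add1n ltnS.
apply/subset_leq_card/subsetP => z; rewrite !inE => /andP[z2].
by rewrite z2; case: eqVneq z2 => [->|_ _]; rewrite ?y2.
Qed.

(** For a basis [B] attaining the rank of [F], the trace on [F :|: A] has size
    [rank M F + #|A :&: (B :\: F)|]. [rank_attained_chain] provides such a [B] for which this is the
    rank of the union. *)
Lemma rank_contraction M F A : [disjoint A & F] ->
  rank (contraction M F) A = (rank M (F :|: A) - rank M F)%N.
Proof.
move=> dAF.
have card_chain B : #|(F :|: A) :&: B| = (#|F :&: B| + #|A :&: (B :\: F)|)%N.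
  rewrite -(cardsID F ((F :|: A) :&: B)); congr (_ + _)%N; apply: eq_card => z.
    by rewrite !inE; case: (z \in F); rewrite ?andbT ?andbF.
  rewrite !inE; have := disjointFr dAF (x := z).
  by case: (z \in F); case: (z \in A) => //= ->.
apply/eqP; rewrite eqn_leq; apply/andP; split.
  apply/bigmax_leqP => _ /imsetP[B + ->]; rewrite inE => /andP[BM /eqP eB].
  have eF : #|F :&: B| = rank M F by rewrite setIC.
  have le := rank_max (F :|: A) BM; rewrite card_chain in le.
  by rewrite -eF leq_subRL // (leq_trans _ le) // leq_addr.
have [B BM [eF eG]] := rank_attained_chain M F A.
rewrite -eF -eG card_chain addKn; apply: rank_max.
by apply: imset_f; rewrite inE BM setIC eF eqxx.
Qed.

Lemma rk_contraction M F : F \subset ground M ->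
  rk (contraction M F) = (rk M - rank M F)%N.
Proof.
move=> FM; rewrite /rk rank_contraction /=; last by rewrite -setI_eq0 setIDAC setDIl setDv setI0.
by congr (rank M _ - _)%N; rewrite -{2}(setID (ground M) F) (setIidPr FM).
Qed.

Lemma rk_deletion M F : rk (deletion M F) = rank M (ground M :\: F).
Proof.
have [B BM eB] := rank_attained M (ground M :\: F).
rewrite (@rk_card _ (B :\: F)) -?eB ?basisD //.
by apply: imset_f; rewrite inE BM -eB basisD ?eqxx.
Qed.

End MatroidRank.

(** * Linear algebra of configurations: vanishing coordinates and rank *)

Section LinearAlgebra.
Variables (K : fieldType) (n : nat).
Implicit Types (U W : {vspace 'rV[K]_n}) (A B F : {set 'I_n}) (u w : 'rV[K]_n).

Definition coord_subspace A : {vspace 'rV[K]_n} :=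
  lker (linfun (mulmxr (diag_mx (\row_i (i \in A)%:R : 'rV[K]_n)))).

Lemma coord_subspaceP A w :
  reflect (forall i, i \in A -> w 0 i = 0) (w \in coord_subspace A).
Proof.
rewrite memv_ker lfunE /=. rewrite mul_mx_diag; apply: (iffP eqP) => [/rowP h i iA|h].
  by have := h i; rewrite !mxE iA mulr1.
by apply/rowP => i; rewrite !mxE; case: (boolP (i \in A)) => [/h->|_]; rewrite ?mul0r ?mulr0.
Qed.

Definition vanishing W A : {vspace 'rV[K]_n} := (W :&: coord_subspace A)%VS.

Lemma vanishingP W A w :
  reflect (w \in W /\ forall i, i \in A -> w 0 i = 0) (w \in vanishing W A).
Proof.
rewrite memv_cap.
by apply: (iffP andP) => -[wW h]; split=> //; apply/coord_subspaceP.
Qed.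

(** Column j evaluates the form sum_(i \notin F) b_i y_i on the projection to [W] of the j-th unit
    vector. These projections span [W], so the kernel consists of the [b] whose form is zero on [W];
    the entries b_i with i in [F] stay free. *)
Definition relations W F : {vspace 'rV[K]_n} :=
  lker (linfun (mulmxr (\matrix_(i < n, j < n)
    ((i \notin F)%:R * projv W (delta_mx 0 j) 0 i)))).

Lemma relationsP W F (b : 'rV[K]_n) :
  reflect (forall u, u \in W -> \sum_(i | i \notin F) b 0 i * u 0 i = 0)
    (b \in relations W F).
Proof.
rewrite memv_ker lfunE /=.
have E j : (b *m \matrix_(i < n, j < n)
    ((i \notin F)%:R * projv W (delta_mx 0 j) 0 i)) 0 j =
    \sum_(i | i \notin F) b 0 i * projv W (delta_mx 0 j) 0 i.
  rewrite mxE [RHS]big_mkcond; apply: eq_bigr => i _; rewrite mxE.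
  by case: (i \in F); rewrite ?mul1r ?mul0r ?mulr0.
apply: (iffP eqP) => [/rowP h u uW|h]; last first.
  by apply/rowP => j; rewrite E mxE h ?memv_proj.
have -> : u = \sum_j u 0 j *: projv W (delta_mx 0 j).
  rewrite -{1}(projv_id uW) {1}(row_sum_delta u) linear_sum.
  by apply: eq_bigr => j _; rewrite linearZ.
under eq_bigr => i _ do rewrite summxE mulr_sumr.
rewrite exchange_big big1 //= => j _.
have := h j; rewrite E mxE => hj.
transitivity (u 0 j * \sum_(i | i \notin F) b 0 i * projv W (delta_mx 0 j) 0 i).
  by rewrite mulr_sumr; apply: eq_bigr => i _; rewrite mxE mulrCA.
by rewrite hj mulr0.
Qed.

(** The vectors [e b] are the preimages of the unit vectors under the isomorphism from [U] to K^B;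
    for [b] outside [B] the conditions force [e b = 0]. *)
Lemma dual_basis U B : B \in config_bases U ->
  exists e : 'I_n -> 'rV[K]_n,
    [/\ forall b, e b \in U,
       forall b i, i \in B -> e b 0 i = (i == b)%:R &
       forall u, u \in U -> u = \sum_(b in B) u 0 b *: e b].
Proof.
case/config_basisP => inj surj.
have [e eP] := choice (fun b =>
  let: ex_intro2 w wU we := surj (fun i => (i == b)%:R) in
  ex_intro (fun w => w \in U /\ forall i, i \in B -> w 0 i = (i == b)%:R)
    w (conj wU we)).
exists e; split=> [b|b i iB|u uU]; try by case: (eP b) => // _ ->.
apply/eqP; rewrite -subr_eq0; apply/eqP/inj.
  by rewrite memvB ?memv_suml // => b _; rewrite memvZ //; case: (eP b).
move=> i iB; rewrite !mxE summxE (bigD1 i) //= big1 => [|b /andP[bB bi]].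
  by rewrite mxE (eP i).2 // eqxx mulr1 addr0 subrr.
by rewrite mxE (eP b).2 // eq_sym (negPf bi) mulr0.
Qed.

(** The vectors of [U] vanishing on [B :\ x] are the multiples of [u], and the nonzero entry [u 0 y]
    tells these multiples apart. *)
Lemma basis_swap U B u x y : B \in config_bases U -> u \in U ->
    (forall i, i \in B -> u 0 i = (i == x)%:R) -> u 0 y != 0 -> y \notin B ->
  y |: (B :\ x) \in config_bases U.
Proof.
move=> /config_basisP[inj surj] uU ue uy yB.
apply/config_basisP; split=> [w wU w0|t].
  have wE : w = w 0 x *: u.
    apply/eqP; rewrite -subr_eq0; apply/eqP/inj.
      by rewrite memvB // memvZ.
    move=> i iB; rewrite !mxE ue //.
    have [->|ix] := eqVneq i x; first by rewrite mulr1 subrr.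
    by rewrite mulr0 subr0 w0 // !inE ix iB orbT.
  have /eqP : w 0 y = 0 by rewrite w0 // !inE eqxx.
  by rewrite wE mxE mulf_eq0 (negPf uy) orbF => /eqP ->; rewrite scale0r.
have [w wU we] := surj t.
exists (w + ((t y - w 0 y) / u 0 y) *: u); first by rewrite memvD // memvZ.
move=> i; rewrite !inE => /orP[/eqP->|/andP[ix iB]].
  by rewrite !mxE divfK // addrC subrK.
by rewrite !mxE [w 0 i]we // [u 0 i]ue // (negPf ix) mulr0 addr0.
Qed.

(** If [y] is not in [B], expand [u] in the basis dual to [B]: some [b] has [u 0 b] and [e b 0 y]
    both nonzero, and [y] may replace it. As [u] vanishes on [A :&: B], this [b] is outside [A]. For
    [B] of maximal trace on [A], a nonzero entry thus becomes a gain of rank. *)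
Lemma basis_through U A B u y : B \in config_bases U -> u \in U ->
    (forall i, i \in A :&: B -> u 0 i = 0) -> u 0 y != 0 ->
  exists2 C, C \in config_bases U & A :&: B \subset C /\ y \in C.
Proof.
move=> hB uU u0 uy; have [yB|yB] := boolP (y \in B).
  by exists B => //; split=> //; apply: subsetIr.
have [e [eU eB ue]] := dual_basis hB.
have [b bB /andP[ub eby]] : exists2 b, b \in B & (u 0 b != 0) && (e b 0 y != 0).
  apply/exists_inP/contraT => /exists_inPn h; move: uy.
  rewrite (ue _ uU) summxE big1 ?eqxx // => b /h; rewrite negb_and !negbK mxE.
  by case/orP=> /eqP->; rewrite ?mul0r ?mulr0.
exists (y |: (B :\ b)); first by apply: basis_swap (eU b) _ eby yB => // i /eB.
split; last by rewrite !inE eqxx.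
apply/subsetP => i iAB; rewrite !inE; apply/orP; right.
have /setIP[_ ->] := iAB; rewrite andbT.
by apply: contraNneq ub => <-; rewrite u0.
Qed.

Section Bases.
Variables (W : {vspace 'rV[K]_n}) (B : {set 'I_n}).
Local Notation M := (config_matroid W).
Hypothesis hB : B \in config_bases W.

(** A nonzero entry at some [y] in [A] would give, through [basis_through], a basis whose trace on
    [A] exceeds the rank. *)
Lemma rank_basis_vanishing A w : #|A :&: B| = rank M A -> w \in W ->
  (forall i, i \in A :&: B -> w 0 i = 0) -> forall i, i \in A -> w 0 i = 0.
Proof.
move=> eB wW w0 y yA; apply/eqP/contraT => wy.
have yAB : y \notin A :&: B by apply: contra wy => /w0->.
have [C hC [sC yC]] := basis_through hB wW w0 wy.
have := rank_max (M := M) A hC; rewrite -eB leqNgt => /negP[].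
have -> : #|A :&: B|.+1 = #|y |: A :&: B| by rewrite cardsU1 yAB.
by rewrite subset_leq_card // subsetI !subUset !sub1set subsetIl yA yC sC.
Qed.

(** This yields the dimension [rk M - rank M A]: vanishing on [A :&: B] already entails vanishing on
    [A], and the entries on [B :\: A] remain free. *)
Lemma vanishing_basis A : #|A :&: B| = rank M A ->
  B :\: A \in config_bases (vanishing W A).
Proof.
move=> eB; have /config_basisP[inj surj] := hB.
apply/config_basisP; split=> [w /vanishingP[wW wA] w0|x].
  apply: inj => // i iB; have [/wA//|iA] := boolP (i \in A).
  by rewrite w0 // inE iA.
have [w wW we] := surj (fun i => if i \in A then 0 else x i).
exists w => [|i /setDP[iB iA]]; last by rewrite we // (negPf iA).
apply/vanishingP; split=> //; apply: rank_basis_vanishing => // i /setIP[iA iB].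
by rewrite we // iA.
Qed.

(** Testing on the basis dual to [B], each [b] in [B :\: A] gives one equation, which determines
    [c 0 b], while each [b] in [B :&: A] gives none. The other entries are free, hence the dimension
    n - rank M (~: A). *)
Lemma relations_basis A : #|~: A :&: B| = rank M (~: A) ->
  ~: (B :\: A) \in config_bases (relations W A).
Proof.
move=> eB; have [e [eW eB1 ue]] := dual_basis hB.
have pick (c : 'rV[K]_n) b : b \in B :\: A ->
    \sum_(i | i \notin A) c 0 i * e b 0 i =
    c 0 b + \sum_(i | (i \notin A) && (i \notin B)) c 0 i * e b 0 i.
  case/setDP=> bB bA; rewrite (bigID (mem B)) /=; congr (_ + _).
  rewrite (bigD1 b) /=; last by rewrite bA.
  rewrite big1 => [|i /andP[/andP[_ iB] ib]]; first by rewrite eB1 ?eqxx ?mulr1 ?addr0.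
  by rewrite eB1 // (negPf ib) mulr0.
apply/config_basisP; split=> [c /relationsP cR c0|x].
  apply/rowP => b; rewrite mxE; have [bBA|] := boolP (b \in B :\: A).
    have := cR _ (eW b); rewrite pick // big1 ?addr0 // => i /andP[_ iB].
    by rewrite c0 ?mul0r // !inE negb_and iB orbT.
  by move=> bBA; rewrite c0 // inE.
pose S b := \sum_(i | (i \notin A) && (i \notin B)) x i * e b 0 i.
exists (\row_i if i \in B :\: A then - S i else x i) => [|i]; last first.
  by rewrite mxE inE => /negPf->.
apply/relationsP => u uW; under eq_bigr => i _ do rewrite {1}(ue u uW) summxE mulr_sumr.
rewrite exchange_big big1 //= => b bB.
set c := \row_i _.
transitivity (u 0 b * \sum_(i | i \notin A) c 0 i * e b 0 i).
  by rewrite mulr_sumr; apply: eq_bigr => i _; rewrite !mxE mulrCA.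
have [bA|bA] := boolP (b \in A).
  (* Maximality of the trace on [~: A] enters here: [e b] vanishes on [~: A :&: B], hence on all of
     [~: A]. *)
  rewrite big1 ?mulr0 // => i iA; rewrite [e b 0 i](_ : _ = 0) ?mulr0 //.
  apply: (rank_basis_vanishing eB (eW b)) => [j|]; last by rewrite inE.
  rewrite !inE => /andP[jA jB]; rewrite eB1 //.
  by case: eqVneq jA => [->|//]; rewrite bA.
have bBA : b \in B :\: A by rewrite inE bA.
rewrite pick // mxE bBA.
rewrite [X in _ + X](_ : _ = S b) ?addNr ?mulr0 //.
apply: eq_bigr => i /andP[iA iB]; by rewrite mxE inE (negPf iB) andbF.
Qed.

End Bases.

(** For [y] outside the zero set, [basis_through] adds [y] to a maximal trace on [F], so the rank
    increases. *)
Lemma flat_zero_set W w : w \in W ->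
  flat (config_matroid W) [set i | w 0 i == 0].
Proof.
set F := [set i | _] => wW; rewrite /flat subsetT /=.
apply/forall_inP => y; rewrite !inE andbT => wy.
have [B hB eB] := rank_attained (config_matroid W) F.
have [||C hC [sC yC]] := basis_through hB wW (A := F) (y := y) => //.
  by move=> i /setIP[]; rewrite inE => /eqP.
apply: leq_trans (rank_max (M := config_matroid W) _ hC); rewrite -eB.
have -> : #|F :&: B|.+1 = #|y |: F :&: B| by rewrite cardsU1 !inE (negPf wy).
by rewrite subset_leq_card // subsetI !subUset !sub1set yC sC !inE eqxx (subset_trans (subsetIl _ _)) ?subsetUr.
Qed.

End LinearAlgebra.

(** * Sums over powersets *)

Section PowersetSums.
Variables (V : zmodType) (T : finType).
Implicit Types A B : {set T}.

Lemma big_powersetU1 (x : T) A (f : {set T} -> V) : x \notin A ->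
  \sum_(B in powerset (x |: A)) f B =
  \sum_(B in powerset A) f B + \sum_(B in powerset A) f (x |: B).
Proof.
move=> xA; rewrite (bigID (fun B => x \in B)) /= addrC; congr (_ + _).
  apply: eq_bigl => B; rewrite !powersetE.
  apply/andP/idP => [[sB xB]|sB].
    apply/subsetP => z zB; have := subsetP sB _ zB.
    by rewrite !inE; case: eqVneq zB xB => [->->|].
  split; first by rewrite (subset_trans sB) ?subsetUr.
  by apply: contra xA => /(subsetP sB).
rewrite (reindex_onto (fun B => x |: B) (fun B => B :\ x)) /= => [|B /andP[_ xB]]; last first.
  by rewrite setD1K.
apply: eq_bigl => B; rewrite !powersetE setU11 andbT.
apply/andP/idP => [[sB /eqP eB]|sB].
  apply/subsetP => z zB; have := subsetP sB z; rewrite !inE zB orbT => /(_ isT).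
  by case: eqVneq => // zx; move: zB; rewrite -eB zx !inE eqxx.
split; first by rewrite setUS.
by rewrite setU1K //; apply: contra xA => /(subsetP sB).
Qed.

End PowersetSums.

Lemma sum_powerset_sign (R : pzRingType) (T : finType) (A : {set T}) :
  A != set0 -> \sum_(B in powerset A) (-1) ^+ #|B| = 0 :> R.
Proof.
case/set0Pn => x xA; rewrite -(setD1K xA) big_powersetU1 ?inE ?eqxx //.
rewrite -big_split big1 //= => B; rewrite powersetE => /subsetP sB.
have xB : x \notin B by apply/negP => /sB; rewrite !inE eqxx.
by rewrite cardsU1 xB exprS mulN1r subrr.
Qed.

(** * The reduced characteristic polynomial of a contraction *)

Section CharPoly.
Variables (E : finType) (M : matroid E).

(** As [F] is not the whole ground set, the signs sum to zero, so each X^k in Whitney's formula may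
    be replaced by X^k - 1 = (X - 1)(1 + ... + X^(k-1)). The division by X - 1 is then exact. *)
Lemma reduced_char_polyE (F : {set E}) : F \subset ground M -> F != ground M ->
  reduced_char_poly (contraction M F) =
  \sum_(A in powerset (ground M :\: F))
    (-1) ^+ #|A| *: \sum_(i < rk M - rank M (F :|: A)) 'X^i.
Proof.
move=> FM nF; rewrite /reduced_char_poly /matroid_char_poly /=.
set S := \sum_(A in _) _ *: \sum_(i < _) _.
suff -> : \sum_(A in powerset (ground M :\: F)) (-1) ^+ #|A| *:
    'X^(rk (contraction M F) - rank (contraction M F) A) = S * ('X - 1) :> {poly int}.
  by rewrite Pdiv.IdomainMonic.mulpK // -polyC1 monicXsubC.
rewrite mulr_suml.
have h : \sum_(A in powerset (ground M :\: F)) ((-1) ^+ #|A|)%:P = 0 :> {poly int}.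
  rewrite -[LHS](raddf_sum (@polyC int)) sum_powerset_sign ?polyC0 //.
  by rewrite setD_eq0; apply: contra nF => ?; rewrite eqEsubset FM.
rewrite -[RHS]addr0 -[X in _ = _ + X]h -big_split /=; apply: eq_bigr => A; rewrite powersetE => sA.
have dA : [disjoint A & F] by rewrite disjoints_subset (subset_trans sA) // subsetDr.
(* Cancelling [rank M F] in truncated subtraction needs it to be at most [rank M (F :|: A)] and at
   most [rk M]. *)
rewrite rk_contraction // rank_contraction // subnBA; last first.
  have [B BM [<- <-]] := rank_attained_chain M F A.
  by rewrite subset_leq_card // setSI // subsetUl.
rewrite subnK; last first.
  have [B BM <-] := rank_attained M F.
  by rewrite (rk_card BM) subset_leq_card // subsetIr.
by rewrite -scalerAl mulrC -subrX1 scalerBr -alg_polyC subrK.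
Qed.

End CharPoly.

(** * Evaluation of integer polynomials in the Grothendieck ring *)

Section Evaluation.
Variable K : closedFieldType.
Implicit Types (p q : {poly int}) (x : K0 K).

(** A common summation range lets polynomials of different sizes be compared termwise. *)
Lemma eval_int_widen p x N : (size p <= N)%N ->
  eval_int p x = \sum_(i < N) x ^+ i *~ p`_i.
Proof.
move=> le; rewrite /eval_int (big_ord_widen N (fun i => x ^+ i *~ p`_i)) // big_mkcond /=.
apply: eq_bigr => i _; case: ltnP => // sz.
by rewrite nth_default.
Qed.

Lemma eval_intD p q x : eval_int (p + q) x = eval_int p x + eval_int q x.
Proof.
set N := maxn (size p) (size q).
rewrite (@eval_int_widen (p + q) _ N) ?size_polyD //.
rewrite (@eval_int_widen p _ N) ?leq_maxl // (@eval_int_widen q _ N) ?leq_maxr //.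
by rewrite -big_split; apply: eq_bigr => i _; rewrite coefD mulrzDr.
Qed.

Lemma eval_intZ (c : int) p x : eval_int (c *: p) x = eval_int p x *~ c.
Proof.
rewrite (@eval_int_widen (c *: p) _ (size p)) ?size_scale_leq //.
rewrite mulrz_suml; apply: eq_bigr => i _; by rewrite coefZ mulrC mulrzA.
Qed.

Lemma eval_int0 x : eval_int 0 x = 0.
Proof. by rewrite /eval_int size_poly0 big_ord0. Qed.

Lemma eval_int_sum I r (P : pred I) (F : I -> {poly int}) x :
  eval_int (\sum_(i <- r | P i) F i) x = \sum_(i <- r | P i) eval_int (F i) x.
Proof. by elim/big_rec2: _ => [|i y1 y2 _ <-]; rewrite ?eval_int0 ?eval_intD. Qed.

Lemma eval_intXn k x : eval_int 'X^k x = x ^+ k.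
Proof.
rewrite (@eval_int_widen _ _ k.+1) ?size_polyXn // big_ord_recr /= coefXn eqxx.
rewrite big1 ?add0r // => i _; by rewrite coefXn ltn_eqF.
Qed.

End Evaluation.

(** * Classes of point sets: cutting, products and isomorphisms *)

Section SetClass.
Variable K : closedFieldType.
Local Notation vec A := ('I_(nvars A) -> K).
Local Notation pol A := {mpoly K[nvars A]}.

Lemma K0_eq_rel (x y : free_ring K) : scissor_relation (x - y) -> \pi_(K0 K) x = \pi_(K0 K) y.
Proof. by move=> h; apply/eqP/K0_eqP; apply: ideal_rel. Qed.

(* The value is 0 when [X] is not locally closed. *)
Definition set_class (A : multiproj) (X : vec A -> Prop) : K0 K :=
  if pselect (locally_closed X) is left h then K0_class (Variety h) else 0.

Lemma set_classE A (X : vec A -> Prop) (h : locally_closed X) :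
  set_class X = K0_class (Variety h).
Proof.
rewrite /set_class; case: pselect => [h'|/(_ h)[]].
by congr (K0_class (Variety _)); apply: Prop_irrelevance.
Qed.

Lemma set_class_points (X : variety K) : set_class (points X) = K0_class X.
Proof. by case: X => A X h; rewrite set_classE. Qed.

Lemma eq_set_class A (X Y : vec A -> Prop) :
  (forall v, X v <-> Y v) -> set_class X = set_class Y.
Proof. by move=> h; congr set_class; apply/funext => v; apply/propext. Qed.

Lemma eq_locally_closed A (X Y : vec A -> Prop) :
  (forall v, X v <-> Y v) -> locally_closed X -> locally_closed Y.
Proof. by move=> h; congr locally_closed; apply/funext => v; apply/propext. Qed.

Lemma locally_closed_point A (X : vec A -> Prop) v :
  locally_closed X -> X v -> is_point v.
Proof. by case=> Z1 [Z2 [[S hS SP] _ XE]] /XE[/SP[]]. Qed.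

Section Cut.
Variables (A : multiproj) (X : vec A -> Prop) (p : pol A).
Hypotheses (hX : locally_closed X) (hp : multihomogeneous p).

Lemma closed_set_hypersurface : closed_set (fun v : vec A => is_point v /\ p.@[v] = 0).
Proof.
exists (fun q => q = p) => [_ ->//|v].
by split=> -[pv h]; split=> //; [move=> _ -> | apply: h].
Qed.

Lemma locally_closed_zero : locally_closed (fun v => X v /\ p.@[v] = 0).
Proof.
have [Z1 [Z2 [[S1 hS1 S1P] hZ2 XE]]] := hX.
exists (fun v => Z1 v /\ p.@[v] = 0), Z2; split=> //.
  exists (fun q => S1 q \/ q = p) => [q [/hS1//|->//]|v].
  split=> [[/S1P[pv h] pv0]|[pv h]].
    by split=> // q [/h|->].
  by split; [apply/S1P; split=> // q Sq; apply: h; left | apply: h; right].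
move=> v; split=> [[/XE[z1 z2] e]|[[z1 e] z2]]; first by [].
by split=> //; apply/XE.
Qed.

Lemma locally_closed_nonzero : locally_closed (fun v => X v /\ p.@[v] != 0).
Proof.
have [Z1 [Z2 [hZ1 [S2 hS2 S2P] XE]]] := hX.
(* The removed closed set is the union of [Z2] and the locus [p = 0], cut out by the products
   [q * p]. *)
exists Z1, (fun v => is_point v /\ forall q, S2 q -> (q * p).@[v] = 0); split=> //.
  exists (fun r => exists2 q, S2 q & r = q * p) => [_ [q /hS2 hq ->]|v].
    exact: multihomogeneousM.
  split=> -[pv h]; split=> //; first by move=> _ [q Sq ->]; apply: h.
  by move=> q Sq; apply: h; exists q.
move=> v; split=> [[/XE[z1 z2] e]|[z1 h]].
  split=> // -[pv h]; apply: z2; apply/S2P; split=> // q /h/eqP.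
  by rewrite mevalM mulf_eq0 (negPf e) orbF => /eqP.
have pv : is_point v by have [S _ SP] := hZ1; case/SP: z1.
split.
  apply/XE; split=> // /S2P[_ h2]; apply: h; split=> // q /h2 q0.
  by rewrite mevalM q0 mul0r.
by apply/eqP => p0; apply: h; split=> // q _; rewrite mevalM p0 mulr0.
Qed.

Lemma set_class_cut : set_class X =
  set_class (fun v => X v /\ p.@[v] = 0) + set_class (fun v => X v /\ p.@[v] != 0).
Proof.
rewrite (set_classE hX) (set_classE locally_closed_zero) (set_classE locally_closed_nonzero).
rewrite -[RHS]/(K0_add _ _) K0_pi_add; apply: K0_eq_rel; apply: rel_cut.
  exists (fun v => is_point v /\ p.@[v] = 0); first exact: closed_set_hypersurface.
  move=> v; split=> [[Xv e]|[Xv [_ e]]] //; split=> //; split=> //.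
  exact: locally_closed_point Xv.
move=> v; split=> [[Xv e]|[Xv n]]; split=> //; first by case=> _; apply/eqP.
by apply/eqP => e; apply: n.
Qed.

End Cut.

(** Cutting the empty set into two empty pieces gives c = c + c for its class c. *)
Lemma set_class0 A (X : vec A -> Prop) : (forall v, ~ X v) -> set_class X = 0.
Proof.
move=> X0; have -> : X = (fun=> False) by apply/funext => v; apply/propext; split=> // /X0.
have h0 := closed_locally_closed (closed_set0 K A).
have := @set_class_cut A (fun=> False) 1 h0 (multihomogeneous1 K A).
have eF (P : vec A -> Prop) : (fun v => False /\ P v) = (fun=> False).
  by apply/funext => v; apply/propext; split=> [[]|].
by rewrite !eF => /eqP; rewrite -subr_eq0 opprD addNKr oppr_eq0 => /eqP.
Qed.

Lemma set_class_prod A1 A2 (X : vec A1 -> Prop) (Y : vec A2 -> Prop) :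
  locally_closed X -> locally_closed Y ->
  set_class (A := mp_prod A1 A2) (fun v => X (fst_coords v) /\ Y (snd_coords v)) =
  set_class X * set_class Y.
Proof.
move=> hX hY; rewrite (set_classE hX) (set_classE hY).
rewrite -[RHS]/(K0_mul _ _) K0_pi_mul.
rewrite (set_classE (prod_locally_closed (Variety hX) (Variety hY))).
by apply: K0_eq_rel; apply: rel_prod.
Qed.

(** Each map is given by one tuple of forms on its whole source, so [regular_map] is checked with
    [h = 1]. The values have a nonzero coordinate in every block because they lie in a locally
    closed set. *)
Lemma set_class_iso A1 A2 (X : vec A1 -> Prop) (Y : vec A2 -> Prop)
    (p : 'I_(nvars A2) -> pol A1) (q : 'I_(nvars A1) -> pol A2) d e :
  locally_closed X -> locally_closed Y ->
  (forall j, has_multidegree (d (block j)) (p j)) ->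
  (forall i, has_multidegree (e (block i)) (q i)) ->
  (forall v, X v -> Y (fun j => (p j).@[v])) ->
  (forall w, Y w -> X (fun i => (q i).@[w])) ->
  (forall v, X v -> same_point (fun i => (q i).@[fun j => (p j).@[v]]) v) ->
  (forall w, Y w -> same_point (fun j => (p j).@[fun i => (q i).@[w]]) w) ->
  set_class X = set_class Y.
Proof.
move=> hX hY hp hq XY YX h1 h2; rewrite (set_classE hX) (set_classE hY).
have refl B (u : vec B) : same_point u u.
  by exists (fun=> 1) => [c|i]; rewrite ?oner_neq0 ?mul1r.
apply: K0_eq_rel; apply: rel_iso.
exists (fun v j => (p j).@[v]), (fun w i => (q i).@[w]); split=> //; split=> // v Xv.
  exists 1, p, d; split=> //; first exact: multihomogeneous1.
    by rewrite meval1 oner_neq0.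
  by move=> v' Xv' _; split=> //; apply: locally_closed_point (XY _ Xv').
exists 1, q, e; split=> //; first exact: multihomogeneous1.
  by rewrite meval1 oner_neq0.
by move=> v' Xv' _; split=> //; apply: locally_closed_point (YX _ Xv').
Qed.

(** * Stratification by the vanishing of a family of forms *)

Section CoordinateStrata.
Variables (A : multiproj) (I : finType) (p : I -> pol A).
Hypothesis hp : forall i, multihomogeneous (p i).
Implicit Types (X : vec A -> Prop) (B C : {set I}).

Lemma locally_closed_stratum X B C : locally_closed X ->
  locally_closed (fun v => X v /\ forall i, i \in B -> ((p i).@[v] == 0) = (i \in C)).
Proof.
have [k] := ubnP #|B|; elim: k B X => // k IH B X hk hX.
have [->|[x xB]] := set_0Vmem B.
  by apply: eq_locally_closed hX => v; split=> [|[]//]; split=> // i; rewrite inE.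
have {}hk : (#|B :\ x| < k)%N by move: hk; rewrite (cardsD1 x B) xB.
have hX' : locally_closed (fun v => X v /\ ((p x).@[v] == 0) = (x \in C)).
  case: (x \in C).
    by apply: eq_locally_closed (locally_closed_zero hX (hp x)) => v; split=> -[? /eqP].
  apply: eq_locally_closed (locally_closed_nonzero hX (hp x)) => v.
  by split=> -[? /negPf] //; split=> //; apply/negbT.
apply: eq_locally_closed (IH _ _ hk hX') => v; split=> [[[Xv ex] h]|[Xv h]].
  split=> // i iB; have [->//|ix] := eqVneq i x.
  by apply: h; rewrite !inE ix.
by split=> [|i]; [split=> //; apply: h | rewrite !inE => /andP[_]; apply: h].
Qed.

(** Cut by one form at a time; [X] varies in the induction because the next cuts apply to both
    pieces. *)
Lemma set_class_strata X B : locally_closed X ->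
  set_class X = \sum_(C in powerset B)
    set_class (fun v => X v /\ forall i, i \in B -> ((p i).@[v] == 0) = (i \in C)).
Proof.
have [k] := ubnP #|B|; elim: k B X => // k IH B X hk hX.
have [->|[x xB]] := set_0Vmem B.
  rewrite powerset0 big_set1; apply: eq_set_class => v.
  by split=> [|[]//]; split=> // i; rewrite inE.
have {}hk : (#|B :\ x| < k)%N by move: hk; rewrite (cardsD1 x B) xB.
rewrite -[in RHS](setD1K xB) big_powersetU1 ?inE ?eqxx //=.
rewrite (set_class_cut hX (hp x)) [RHS]addrC.
rewrite (IH _ _ hk (locally_closed_zero hX (hp x))) (IH _ _ hk (locally_closed_nonzero hX (hp x))).
congr (_ + _); apply: eq_bigr => C; rewrite powersetE => /subsetP sC; apply: eq_set_class => v.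
  split=> [[[Xv e] h]|[Xv h]].
    split=> // i; rewrite !inE; case: eqVneq => [-> _|ix /= iB]; first by rewrite e eqxx.
    by rewrite h // !inE ix.
  split=> [|i]; first by split=> //; apply/eqP; rewrite h ?setU11.
  by rewrite !inE => /andP[ix iB]; rewrite h !inE ?iB ?ix ?(negPf ix) ?orbT.
have xC : x \notin C by apply/negP => /sC; rewrite !inE eqxx.
split=> [[[Xv e] h]|[Xv h]].
  split=> // i; rewrite !inE; case: eqVneq => [-> _|ix /= iB].
    by rewrite (negPf e) (negPf xC).
  by rewrite h // !inE ix.
split=> [|i]; first by split=> //; rewrite h ?setU11.
by rewrite !inE => /andP[ix iB]; rewrite h // !inE ix iB orbT.
Qed.

(** Inclusion-exclusion by induction on [B]: the locus for [B] is the one for [B :\ x] minus its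
    part on [p x = 0], which is the same problem with [X] cut down to that hypersurface. *)
Lemma set_class_nonvanishing X B : locally_closed X ->
  set_class (fun v => X v /\ forall i, i \in B -> (p i).@[v] != 0) =
  \sum_(C in powerset B) (-1) ^+ #|C| *
    set_class (fun v => X v /\ forall i, i \in C -> (p i).@[v] = 0).
Proof.
have [k] := ubnP #|B|; elim: k B X => // k IH B X hk hX.
have [->|[x xB]] := set_0Vmem B.
  rewrite powerset0 big_set1 cards0 mul1r; apply: eq_set_class => v.
  by split=> -[Xv _]; split=> // i; rewrite inE.
have {}hk : (#|B :\ x| < k)%N by move: hk; rewrite (cardsD1 x B) xB.
have hX' := locally_closed_zero hX (hp x).
have hY : locally_closed (fun v => X v /\ forall i, i \in B :\ x -> (p i).@[v] != 0).
  apply: eq_locally_closed (locally_closed_stratum (B :\ x) set0 hX) => v.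
  split=> -[Xv h]; split=> // i /h; first by rewrite in_set0 => ->.
  by rewrite in_set0 => /negPf.
transitivity (set_class (fun v => X v /\ forall i, i \in B :\ x -> (p i).@[v] != 0) -
    set_class (fun v => (X v /\ (p x).@[v] = 0) /\
      forall i, i \in B :\ x -> (p i).@[v] != 0)).
  rewrite (set_class_cut hY (hp x)).
  set a := set_class _; set b := set_class _; set c := set_class _; set d := set_class _.
  have -> : b = d by apply: eq_set_class => v; split=> -[[]].
  rewrite addrAC subrr add0r; apply: eq_set_class => v; split=> [[Xv h]|[[Xv h] xv]].
    by split; [split=> // i; rewrite !inE => /andP[_]; apply: h | apply: h].
  split=> // i iB; have [->//|ix] := eqVneq i x.
  by apply: h; rewrite !inE ix.
rewrite -[in RHS](setD1K xB) big_powersetU1 ?inE ?eqxx //=.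
congr (_ + _); first exact: IH.
rewrite (IH _ _ hk hX') -sumrN; apply: eq_bigr => C; rewrite powersetE => /subsetP sC.
have xC : x \notin C by apply/negP => /sC; rewrite !inE eqxx.
rewrite cardsU1 xC exprS mulN1r mulNr; congr (- (_ * _)).
apply: eq_set_class => v; split=> [[[Xv e] h]|[Xv h]].
  by split=> // i; rewrite !inE => /predU1P[->|/h].
split=> [|i iC]; first by split=> //; apply: h; rewrite setU11.
by apply: h; rewrite !inE iC orbT.
Qed.

End CoordinateStrata.
End SetClass.

(** * Multidegrees of sums and products of forms *)

Section Multidegrees.
Variables (K : closedFieldType) (A : multiproj).
Local Notation pol := {mpoly K[nvars A]}.
Implicit Types (d : 'I_(nblocks A) -> nat) (p q : pol).

Lemma multihomogeneousX i : multihomogeneous ('X_i : pol).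
Proof. by eexists; apply: has_multidegreeX. Qed.

Lemma has_multidegreeZ d (a : K) p : has_multidegree d p -> has_multidegree d (a *: p).
Proof. by move=> hp m /msuppZ_le; apply: hp. Qed.

Lemma has_multidegreeD d p q :
  has_multidegree d p -> has_multidegree d q -> has_multidegree d (p + q).
Proof. by move=> hp hq m /msuppD_le; rewrite mem_cat => /orP[/hp|/hq]. Qed.

Lemma has_multidegree_prod (I : Type) (r : seq I) (P : pred I)
    (d : I -> 'I_(nblocks A) -> nat) (p : I -> pol) :
  (forall i, has_multidegree (d i) (p i)) ->
  has_multidegree (fun c => \sum_(i <- r | P i) d i c)%N (\prod_(i <- r | P i) p i).
Proof.
move=> hp; elim: r => [|i r IH] m.
  by rewrite big_nil msupp1 inE => /eqP-> c; rewrite big_nil big1 // => i _; rewrite mnm0E.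
rewrite big_cons; case Pi: (P i) => hm c; rewrite big_cons Pi; last exact: IH.
exact: (has_multidegreeM (hp i) IH).
Qed.

End Multidegrees.

(** * The class of the projective space of a subspace *)

Section ProjectiveSubspaces.
Variables (K : closedFieldType) (n : nat).
Local Notation L := (lefschetz K).
Local Notation Pn := (proj_space n).
Implicit Types (U W : {vspace 'rV[K]_n}) (B : {set 'I_n}) (v : 'I_n -> K).

Definition proj_subspace U v := is_point (A := Pn) v /\ \row_i v i \in U.

Lemma is_point_proj_space m (v : 'I_m -> K) :
  is_point (A := proj_space m) v <-> exists i, v i != 0.
Proof.
split=> [/(_ ord0)[i _ vi]|[i vi] c]; first by exists i.
by exists i => //; rewrite (ord1 c).
Qed.

Lemma has_multidegreeX1 m (i : 'I_m) :
  has_multidegree (A := proj_space m) (fun=> 1%N) ('X_i : {mpoly K[m]}).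
Proof.
have := @has_multidegreeX K (proj_space m) i.
by congr has_multidegree; apply/funext => c; rewrite (ord1 c).
Qed.

Lemma proj_subspace_locally_closed U :
  locally_closed (A := Pn) (proj_subspace U).
Proof.
apply: closed_locally_closed.
(* [U] is the kernel of [D], whose coordinates are therefore linear equations for [U]. *)
pose D := (\1 - projv U)%VF.
have DP w : (w \in U) = (D w == 0).
  rewrite add_lfunE opp_lfunE id_lfunE subr_eq0 eq_sym.
  by apply/idP/eqP => [/projv_id//|<-]; apply: memv_proj.
pose f j : {mpoly K[n]} := \sum_(i < n) D (delta_mx 0 i) 0 j *: 'X_i.
exists (fun p => exists j, p = f j) => [_ [j ->]|v].
  by exists (fun=> 1%N); apply: has_multidegree_sum => i; apply: has_multidegreeX1.
have fE j : (f j).@[v] = D (\row_i v i) 0 j.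
  rewrite [\row_i _](row_sum_delta) /f raddf_sum [in RHS]linear_sum summxE /=.
  by apply: eq_bigr => i _; rewrite mevalZ mevalXU [in RHS]linearZ !mxE mulrC.
split=> [[pv vU]|[pv h]]; split=> //.
  by move=> _ [j ->]; rewrite fE; move: vU; rewrite DP => /eqP->; rewrite mxE.
by rewrite DP; apply/eqP/rowP => j; rewrite -fE mxE; apply: h; exists j.
Qed.

Lemma class_affine_line : set_class (points (affine_line K)) = L.
Proof. exact: set_class_points. Qed.

Lemma class_point : set_class (points (point_variety K)) = 1.
Proof. by rewrite set_class_points; apply: K0_eq_rel; apply: rel_point. Qed.

Definition chart U x v := proj_subspace U v /\ ('X_x : {mpoly K[n]}).@[v] != 0.

Lemma chart_locally_closed U x : locally_closed (A := Pn) (chart U x).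
Proof.
apply: locally_closed_nonzero; first exact: proj_subspace_locally_closed.
exact: multihomogeneousX.
Qed.

(** Since [y] is in [B], the trace of [B] on [[set y]] has the maximal possible size 1, and
    [vanishing_basis] applies. *)
Lemma basis_setD1 U B y : B \in config_bases U -> y \in B ->
  B :\ y \in config_bases (vanishing U [set y]).
Proof.
move=> hB yB; apply: vanishing_basis => //; apply/eqP; rewrite eqn_leq rank_max //=.
rewrite (_ : #|[set y] :&: B| = 1%N); last by rewrite (setIidPl _) ?sub1set ?cards1.
by apply/bigmax_leqP => C _; rewrite -(cards1 y) subset_leq_card ?subsetIl.
Qed.

(** [U] is the line spanned by [e x], so the chart is a single point and constant maps give the
    isomorphism. *)
Lemma class_chart_set1 U x : [set x] \in config_bases U ->
  set_class (A := Pn) (chart U x) = 1.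
Proof.
move=> hx; have [e [eU ex ue]] := dual_basis hx; rewrite -class_point.
have exx : e x 0 x = 1 by rewrite ex ?inE ?eqxx.
apply: (@set_class_iso K Pn (proj_space 1) _ _ (fun=> 1) (fun i => (e x 0 i)%:MP)
  (fun _ _ => 0%N) (fun _ _ => 0%N)) => //.
- exact: chart_locally_closed.
- exact: point_locally_closed.
- by move=> _ m; rewrite msupp1 inE => /eqP-> c; apply: big1 => i _; rewrite mnm0E.
- move=> i m; rewrite msuppC; case: ifP => // _; rewrite inE => /eqP-> c.
  by apply: big1 => j _; rewrite mnm0E.
- by move=> v _; apply/is_point_proj_space; exists ord0; rewrite meval1 oner_neq0.
- move=> v _; split; last by rewrite mevalXU mevalC exx oner_neq0.
  split; first by apply/is_point_proj_space; exists x; rewrite mevalC exx oner_neq0.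
  by rewrite (_ : \row_i _ = e x) //; apply/rowP => i; rewrite mxE mevalC.
- move=> v [[_ vU]]; rewrite mevalXU => vx.
  exists (fun=> v x) => // i; rewrite mevalC.
  have /rowP/(_ i) := ue _ vU; by rewrite big_set1 !mxE => ->.
- move=> w /is_point_proj_space[i wi]; rewrite (ord1 i) in wi.
  by exists (fun=> w ord0) => // j; rewrite meval1 mulr1 (ord1 j).
Qed.

(* The isomorphism is u |-> (u - u_y e_y, [u_x : u_y]) with inverse
   (u, [s : t]) |-> s u + t u_x e_y. *)
Lemma chart_retract U B x y : B \in config_bases U -> x \in B -> y \in B -> x != y ->
  set_class (A := Pn) (chart U x) =
  set_class (A := Pn) (chart (vanishing U [set y]) x) * L.
Proof.
move=> hB xB yB xy; have [e [eU eB ue]] := dual_basis hB.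
have exy : e y 0 x = 0 by rewrite eB // (negPf xy).
have eyy : e y 0 y = 1 by rewrite eB // eqxx.
rewrite -class_affine_line -set_class_prod; last first.
- exact: points_locally_closed.
- exact: chart_locally_closed.
pose p (j : 'I_(n + 2)) : {mpoly K[n]} :=
  match split j with
  | inl i => 'X_i + (- e y 0 i) *: 'X_y
  | inr k => if k == ord0 then 'X_x else 'X_y
  end.
pose q i : {mpoly K[n + 2]} :=
  'X_(rshift n ord0) * 'X_(lshift 2 i) +
  e y 0 i *: ('X_(rshift n ord_max) * 'X_(lshift 2 x)).
have pl i : p (lshift 2 i) = 'X_i + (- e y 0 i) *: 'X_y by rewrite /p (unsplitK (inl i)).
have pr0 : p (rshift n ord0) = 'X_x by rewrite /p (unsplitK (inr ord0)).
have pr1 : p (rshift n ord_max) = 'X_y by rewrite /p (unsplitK (inr ord_max)).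
have plE v i : (p (lshift 2 i)).@[v] = v i - v y * e y 0 i.
  by rewrite pl mevalD mevalZ !mevalXU mulNr mulrC.
have qE w i : (q i).@[w] = w (rshift n ord0) * w (lshift 2 i) +
    e y 0 i * (w (rshift n ord_max) * w (lshift 2 x)).
  by rewrite mevalD mevalZ !mevalM !mevalXU.
apply: (@set_class_iso K Pn (mp_prod Pn (proj_space 2)) _ _ p q
  (fun _ _ => 1%N) (fun _ _ => 1%N)).
- exact: chart_locally_closed.
- exact: (prod_locally_closed (Variety (chart_locally_closed _ x)) (affine_line K)).
- move=> j; rewrite /p; case: (split j) => [i|k].
    by apply: has_multidegreeD; [|apply: has_multidegreeZ]; apply: has_multidegreeX1.
  by case: ifP => _; apply: has_multidegreeX1.
- have deg2 i k : has_multidegree (A := mp_prod Pn (proj_space 2)) (fun=> 1%N)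
      ('X_(rshift n k) * 'X_(lshift 2 i) : {mpoly K[n + 2]}).
    have := has_multidegreeM (@has_multidegreeX K (mp_prod Pn (proj_space 2)) (rshift n k))
      (@has_multidegreeX K (mp_prod Pn (proj_space 2)) (lshift 2 i)).
    congr has_multidegree; apply/funext => c.
    rewrite (@block_l Pn (proj_space 2)) (@block_r Pn (proj_space 2)) /=.
    by case: (split_ordP c) => c' ->; rewrite (ord1 c') ?eq_lrshift ?eq_rlshift eqxx.
  by move=> i; apply: has_multidegreeD; [|apply: has_multidegreeZ]; apply: deg2.
- move=> v [[_ vU]]; rewrite mevalXU => vx.
  have px : (p (lshift 2 x)).@[v] != 0 by rewrite plE exy mulr0 subr0.
  split; first split; first split.
  + by apply/is_point_proj_space; exists x.
  + rewrite (_ : \row_i _ = (\row_i v i) - v y *: e y); last first.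
      by apply/rowP => i; rewrite !mxE /fst_coords plE.
    apply/vanishingP; split; first by rewrite memvB // memvZ.
    by move=> i /set1P->; rewrite !mxE eyy mulr1 subrr.
  + by rewrite mevalXU.
  + split; last by rewrite /snd_coords pr0 mevalXU.
    by apply/is_point_proj_space; exists ord0; rewrite /snd_coords pr0 mevalXU.
- move=> w [[[_ /vanishingP[wU wy]]]]; rewrite mevalXU => wx [_ w0].
  have qx : (q x).@[w] != 0 by rewrite qE exy mul0r addr0 mulf_neq0.
  split; last by rewrite mevalXU.
  split; first by apply/is_point_proj_space; exists x.
  rewrite (_ : \row_i _ = w (rshift n ord0) *: (\row_i fst_coords w i) +
    (w (rshift n ord_max) * w (lshift 2 x)) *: e y).
    by rewrite memvD // memvZ.
  by apply/rowP => i; rewrite !mxE qE [e y 0 i * _]mulrC.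
(* [q] after [p] multiplies by [v x]; in the other order the vector u is multiplied by s and the
   pair [s : t] by u_x. These factors are nonzero on the sets concerned. *)
- move=> v [_]; rewrite mevalXU => vx; exists (fun=> (v x)^-1).
    by move=> _; rewrite invr_eq0.
  move=> i; rewrite qE !plE pr0 pr1 !mevalXU exy mulr0 subr0.
  have -> : v x * (v i - v y * e y 0 i) + e y 0 i * (v y * v x) = v x * v i.
    by rewrite mulrBr [e y 0 i * _]mulrC [v y * v x]mulrC mulrA subrK.
  by rewrite mulKf.
- move=> w [[[_ /vanishingP[wU wy]]]]; rewrite mevalXU => wx [_ w0].
  have {}wy : w (lshift 2 y) = 0 by have := wy y (set11 y); rewrite mxE.
  have qx : (q x).@[w] = w (rshift n ord0) * w (lshift 2 x) by rewrite qE exy mul0r addr0.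
  have qy : (q y).@[w] = w (rshift n ord_max) * w (lshift 2 x).
    by rewrite qE wy eyy mulr0 add0r mul1r.
  exists (fun c : 'I_(1 + 1) => if c == lshift 1 ord0 then (w (rshift n ord0))^-1
                   else (w (lshift 2 x))^-1) => [c|j].
    by case: ifP => _; rewrite invr_eq0.
  case: (split_ordP j) => k ->.
    rewrite (@block_l Pn (proj_space 2)) eqxx plE qy qE.
    by rewrite [e y 0 k * _]mulrC addrK mulKf.
  rewrite (@block_r Pn (proj_space 2)) eq_rlshift.
  have [->|k0] := eqVneq k ord0; first by rewrite pr0 mevalXU qx mulrC mulfK.
  have -> : k = ord_max by apply/val_inj; case: k k0 => -[|[]].
  by rewrite pr1 mevalXU qy mulrC mulfK.
Qed.

(** [chart_retract] removes each element of [B] other than [x] at the cost of a factor [L], until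
    the basis is [[set x]] and the chart a point. *)
Lemma class_chart U B x : B \in config_bases U -> x \in B ->
  set_class (A := Pn) (chart U x) = L ^+ #|B|.-1.
Proof.
have [k] := ubnP #|B|; elim: k U B => // k IH U B hk hB xB.
have [/eqP|/set0Pn[y]] := eqVneq (B :\ x) set0.
  rewrite setD_eq0 => sB; have eB : B = [set x] by apply/eqP; rewrite eqEsubset sB sub1set.
  by rewrite class_chart_set1 -?eB // eB cards1.
rewrite !inE => /andP[yx yB].
have xy : x \in B :\ y by rewrite !inE eq_sym yx.
have cB : #|B| = #|B :\ y|.+1 by rewrite (cardsD1 y B) yB.
rewrite (chart_retract hB xB yB) 1?eq_sym // (IH _ _ _ (basis_setD1 hB yB)) //; last by rewrite -cB.
by rewrite cB /= -exprSr prednK //; apply/card_gt0P; exists x.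
Qed.

(** The hyperplane where coordinate [x] vanishes cuts P(U) into the projective space of a subspace
    of one dimension less and a chart, which contributes the top power of [L]. For empty [B] there
    are no points. *)
Lemma class_proj_subspace U B : B \in config_bases U ->
  set_class (A := Pn) (proj_subspace U) = \sum_(i < #|B|) L ^+ i.
Proof.
have [k] := ubnP #|B|; elim: k U B => // k IH U B hk hB.
have [B0|[x xB]] := set_0Vmem B.
  rewrite B0 cards0 big_ord0; apply: set_class0 => v [/is_point_proj_space[i vi] vU].
  have [e [eU eB ue]] := dual_basis hB.
  by move: vi; have /rowP/(_ i) := ue _ vU; rewrite B0 big_set0 !mxE => ->; rewrite eqxx.
have cB : #|B| = #|B :\ x|.+1 by rewrite (cardsD1 x B) xB.
rewrite (set_class_cut (proj_subspace_locally_closed U) (multihomogeneousX K (A := Pn) x)).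
rewrite [X in _ + X](class_chart hB xB) [in RHS]cB big_ord_recr cB; congr (_ + _).
rewrite -(IH _ _ _ (basis_setD1 hB xB)) -?cB //.
apply: eq_set_class => v; rewrite /proj_subspace mevalXU; split.
  case=> [[pv vU] vx]; split=> //; apply/vanishingP; split=> // i /set1P->.
  by rewrite mxE.
case=> pv /vanishingP[vU /(_ x (set11 x))]; by rewrite mxE.
Qed.

End ProjectiveSubspaces.

(** * The strata of Lambda and their classes *)

Section LambdaStrata.
Variables (K : closedFieldType) (n : nat) (W : {vspace 'rV[K]_n}).
Local Notation L := (lefschetz K).
Local Notation M := (config_matroid W).
Local Notation Pn := (proj_space n).
Local Notation PP := (mp_prod Pn Pn).
Implicit Types F : {set 'I_n}.

Definition open_stratum F (v : 'I_n -> K) :=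
  proj_subspace W v /\
  forall i, i \in [set: 'I_n] -> (('X_i : {mpoly K[n]}).@[v] == 0) = (i \in F).

Lemma open_stratum_locally_closed F : locally_closed (A := Pn) (open_stratum F).
Proof.
apply: (locally_closed_stratum (A := Pn) (p := fun i => 'X_i)).
  by move=> i; apply: (multihomogeneousX K (A := Pn)).
exact: proj_subspace_locally_closed.
Qed.

Lemma class_open_stratum F : set_class (A := Pn) (open_stratum F) =
  \sum_(A in powerset (~: F)) (-1) ^+ #|A| * \sum_(i < rk M - rank M (F :|: A)) L ^+ i.
Proof.
(* Vanishing on [F] is absorbed into the subspace, which leaves only the nonvanishing outside [F] to
   inclusion-exclusion. *)
transitivity (set_class (A := Pn) (fun v => proj_subspace (vanishing W F) v /\
    forall i, i \in ~: F -> ('X_i : {mpoly K[n]}).@[v] != 0)).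
  apply: eq_set_class => v; split=> [[[pv vW] h]|[[pv /vanishingP[vW v0]] h]].
    split=> [|i]; last by rewrite h // inE.
    split=> //; apply/vanishingP; split=> // i iF; rewrite mxE.
    by apply/eqP; rewrite -mevalXU h.
  split=> // i _; have [iF|iF] := boolP (i \in F).
    by have := v0 i iF; rewrite mxE mevalXU => ->; rewrite eqxx.
  by apply/negbTE/h; rewrite inE.
rewrite (set_class_nonvanishing (A := Pn) (p := fun i => 'X_i)); last first.
- exact: proj_subspace_locally_closed.
- by move=> i; apply: (multihomogeneousX K (A := Pn)).
apply: eq_bigr => A _; congr (_ * _).
(* As [B] attains the rank of [F :|: A], the subspace vanishing there has basis [B :\: (F :|: A)],
   of size [rk M - rank M (F :|: A)]. *)
have [B hB eB] := rank_attained M (F :|: A).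
rewrite (rk_card hB) -eB setIC -cardsD.
rewrite -(class_proj_subspace (vanishing_basis hB eB)).
apply: eq_set_class => v; split=> [[[pv /vanishingP[vW v0]] h]|[pv /vanishingP[vW v0]]].
  split=> //; apply/vanishingP; split=> // i; rewrite inE => /orP[/v0//|/h].
  by rewrite mevalXU mxE.
split=> [|i iA]; last by have := v0 i; rewrite inE iA orbT mxE mevalXU => ->.
split=> //; apply/vanishingP; split=> // i iF; apply: v0; by rewrite inE iF.
Qed.

Definition Lambda_stratum F (v : 'I_(n + n) -> K) :=
  Lambda_points W v /\ forall i, i \in [set: 'I_n] ->
    (('X_(lshift n i) : {mpoly K[n + n]}).@[v] == 0) = (i \in F).

Lemma Lambda_stratum_locally_closed F :
  locally_closed (A := PP) (Lambda_stratum F).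
Proof.
apply: (locally_closed_stratum (A := PP) (p := fun i => 'X_(lshift n i))).
  by move=> i; apply: (multihomogeneousX K (A := PP)).
exact: Lambda_locally_closed.
Qed.

(* The coordinates [beta i * w i], with [w i] replaced by a fixed nonzero [w j]
   where it vanishes, trivialize the family of fibres over the whole stratum. *)
Lemma class_Lambda_stratum F j : j \notin F ->
  set_class (A := PP) (Lambda_stratum F) =
  set_class (A := Pn) (open_stratum F) *
  set_class (A := Pn) (proj_subspace (relations W F)).
Proof.
move=> jF.
have hS := open_stratum_locally_closed F.
have hR := proj_subspace_locally_closed (relations W F).
rewrite -set_class_prod //.
pose c i := if i \in F then j else i.
have cF i : c i \notin F by rewrite /c; case: ifP => // /negbT.
pose p (k : 'I_(n + n)) : {mpoly K[n + n]} := match split k with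
  | inl i => 'X_(lshift n i)
  | inr i => 'X_(rshift n i) * 'X_(lshift n (c i))
  end.
(* The inverse avoids dividing by the coordinate of index [c i]: it multiplies by all other first
   coordinates outside [F], so that both composites scale the second factor by the full product
   [T]. *)
pose q (k : 'I_(n + n)) : {mpoly K[n + n]} := match split k with
  | inl i => 'X_(lshift n i)
  | inr i => 'X_(rshift n i) * \prod_(l | (l \notin F) && (l != c i)) 'X_(lshift n l)
  end.
have pl v i : (p (lshift n i)).@[v] = v (lshift n i).
  by rewrite /p (unsplitK (inl i)) mevalXU.
have pr v i : (p (rshift n i)).@[v] = v (rshift n i) * v (lshift n (c i)).
  by rewrite /p (unsplitK (inr i)) mevalM !mevalXU.
pose Q v i : K := \prod_(l | (l \notin F) && (l != c i)) v (lshift n l).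
pose T v : K := \prod_(l | l \notin F) v (lshift n l).
have QT v i : v (lshift n (c i)) * Q v i = T v by rewrite /T (bigD1 (c i)).
have ql v i : (q (lshift n i)).@[v] = v (lshift n i).
  by rewrite /q (unsplitK (inl i)) mevalXU.
have qr v i : (q (rshift n i)).@[v] = v (rshift n i) * Q v i.
  rewrite /q (unsplitK (inr i)) mevalM mevalXU; congr (_ * _).
  by rewrite rmorph_prod; apply: eq_bigr => l _; rewrite /= mevalXU.
have T0 v : (forall i, i \in [set: 'I_n] -> (v (lshift n i) == 0) = (i \in F)) -> T v != 0.
  by move=> h; apply/prodf_neq0 => l lF; rewrite h.
have pt_scale (v : 'I_(n + n) -> K) (f : 'I_n -> K) g :
    (forall i, f i != 0) -> (forall i, g (rshift n i) = v (rshift n i) * f i) ->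
    (exists i, v (rshift n i) != 0) -> exists i, g (rshift n i) != 0 :> K.
  by move=> f0 gE [i vi]; exists i; rewrite gE mulf_neq0.
(* Bidegrees of the two maps: (1, 0) for the components in the first factor and (m, 1) for those in
   the second, with m = 1 for [p] and m = [#|~: F|.-1] for [q]. *)
pose D (m : nat) (b b' : 'I_(1 + 1)) : nat :=
  if b == lshift 1 ord0 then nat_of_bool (lshift 1 ord0 == b') else
  if b' == lshift 1 ord0 then m else 1%N.
have degl i : has_multidegree (A := PP) (fun b' : 'I_(1 + 1) => nat_of_bool (lshift 1 ord0 == b'))
    ('X_(lshift n i) : {mpoly K[n + n]}).
  by have := @has_multidegreeX K PP (lshift n i); rewrite (@block_l Pn Pn).
have degr i : has_multidegree (A := PP) (fun b' : 'I_(1 + 1) => nat_of_bool (rshift 1 ord0 == b'))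
    ('X_(rshift n i) : {mpoly K[n + n]}).
  by have := @has_multidegreeX K PP (rshift n i); rewrite (@block_r Pn Pn).
apply: (@set_class_iso K PP PP _ _ p q (D 1%N) (D #|~: F|.-1)).
- exact: Lambda_stratum_locally_closed.
- exact: (prod_locally_closed (Variety hS) (Variety hR)).
- move=> k; case: (split_ordP k) => i ->.
    by rewrite /p (unsplitK (inl i)) (@block_l Pn Pn) /D eqxx.
  rewrite /p (unsplitK (inr i)) (@block_r Pn Pn) /D eq_rlshift.
  have := has_multidegreeM (degr i) (degl (c i)).
  congr has_multidegree; apply/funext => b.
  by case: (split_ordP b) => b' ->; rewrite (ord1 b') ?eqxx ?eq_lrshift ?eq_rlshift.
- move=> k; case: (split_ordP k) => i ->.
    by rewrite /q (unsplitK (inl i)) (@block_l Pn Pn) /D eqxx.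
  rewrite /q (unsplitK (inr i)) (@block_r Pn Pn) /D eq_rlshift.
  have := has_multidegreeM (degr i) (@has_multidegree_prod K PP _ (index_enum _)
    (fun l => (l \notin F) && (l != c i)) _ _ degl).
  congr has_multidegree; apply/funext => b; rewrite sum_nat_const.
  have -> : #|[pred l | (l \notin F) && (l != c i)]| = #|~: F|.-1.
    rewrite (cardsD1 (c i) (~: F)) !inE cF add1n /=.
    by apply: eq_card => l; rewrite !inE andbC.
  by case: (split_ordP b) => b' ->;
    rewrite (ord1 b') ?eqxx ?eq_lrshift ?eq_rlshift ?muln1 ?muln0.
- move=> v [[/is_point_prod[pw pb] vW h] v0].
  have {}v0 i : (v (lshift n i) == 0) = (i \in F) by rewrite -v0 ?inE // mevalXU.
  have ef : @fst_coords K Pn Pn (fun k => (p k).@[v]) = @fst_coords K Pn Pn v.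
    by apply/funext => i; apply: pl.
  rewrite ef; split.
    by split=> // i _; rewrite mevalXU; apply: v0.
  split.
    apply/is_point_proj_space; apply: (pt_scale v (fun i => v (lshift n (c i))) (fun k => (p k).@[v])) => //.
      by move=> i; rewrite v0.
    by have /is_point_proj_space := pb.
  (* Terms with i in [F] vanish with w_i, and [c i = i] outside [F], so the equation of Lambda is
     the relation for b_i = beta_i w_i. *)
  apply/relationsP => u uW; rewrite -[RHS](h u uW).
  rewrite [RHS](bigID (fun i => i \in F)) /= [X in X + _]big1 ?add0r => [|i iF].
    apply: eq_bigr => i iF; rewrite mxE /snd_coords pr /c (negPf iF) //.
  have /eqP : v (lshift n i) == 0 by rewrite v0.
  by rewrite /fst_coords => ->; rewrite mulr0 mul0r.
- move=> v [[[pw vW] v0] [pb /relationsP h]].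
  have {}v0 i : (v (lshift n i) == 0) = (i \in F) by rewrite -v0 ?inE // mevalXU.
  have ef : @fst_coords K Pn Pn (fun k => (q k).@[v]) = @fst_coords K Pn Pn v.
    by apply/funext => i; apply: ql.
  have Q0 i : Q v i != 0 by apply/prodf_neq0 => l /andP[lF _]; rewrite v0.
  split; last by move=> i _; rewrite mevalXU ql v0.
  split; rewrite ?ef //.
    apply/is_point_prod; rewrite ef; split=> //.
    apply/is_point_proj_space; apply: (pt_scale v (Q v) (fun k => (q k).@[v])) => //.
    by have /is_point_proj_space := pb.
  move=> u uW; rewrite (bigID (fun i => i \in F)) /= [X in X + _]big1 ?add0r => [|i iF].
    (* Outside [F] one has w_i * [Q v i] = [T v], so the equation of Lambda at the image is [T v]
       times the given relation. *)
    transitivity (T v * \sum_(i | i \notin F) (\row_k snd_coords v k) 0 i * u 0 i).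
      rewrite mulr_sumr; apply: eq_bigr => i iF.
      have := QT v i; rewrite {1}/c (negPf iF) => <-.
      rewrite mxE /snd_coords /fst_coords qr !mulrA; congr (_ * _).
      by rewrite [RHS]mulrC [RHS]mulrCA [RHS]mulrC.
    by rewrite h // mulr0.
  have /eqP : v (lshift n i) == 0 by rewrite v0.
  by rewrite /fst_coords => ->; rewrite mulr0 mul0r.
- move=> v [_ v0].
  have Tv : T v != 0.
    by apply: T0 => i iT; rewrite -v0 // mevalXU.
  (* The composite fixes the first factor and multiplies the second by [T v], whence the scalars 1
     and [(T v)^-1]. *)
  exists (fun b : 'I_(1 + 1) => if b == lshift 1 ord0 then 1 else (T v)^-1) => [b|k].
    by case: ifP => _; rewrite ?oner_neq0 ?invr_eq0.
  case: (split_ordP k) => i ->.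
    by rewrite (@block_l Pn Pn) eqxx ql pl mul1r.
  rewrite (@block_r Pn Pn) eq_rlshift qr pr.
  have -> : Q (fun k => (p k).@[v]) i = Q v i by apply: eq_bigr => l _; rewrite pl.
  by rewrite -mulrA QT mulrC mulfK.
move=> v [[_ v0] _].
have Tv : T v != 0.
  by apply: T0 => i iT; rewrite -v0 // mevalXU.
exists (fun b : 'I_(1 + 1) => if b == lshift 1 ord0 then 1 else (T v)^-1) => [b|k].
  by case: ifP => _; rewrite ?oner_neq0 ?invr_eq0.
case: (split_ordP k) => i ->.
  by rewrite (@block_l Pn Pn) eqxx pl ql mul1r.
rewrite (@block_r Pn Pn) eq_rlshift pr qr ql.
by rewrite -mulrA [Q v i * _]mulrC QT mulrC mulfK.
Qed.

End LambdaStrata.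

(** At a point of the stratum, [F] is the zero set of a nonzero vector of [W]: a flat by
    [flat_zero_set], and proper because some coordinate is nonzero. *)
Lemma Lambda_stratum_eq0 (K : closedFieldType) n (W : {vspace 'rV[K]_n}) (F : {set 'I_n}) :
  ~~ (flat (config_matroid W) F && (F != [set: 'I_n])) ->
  set_class (A := mp_prod (proj_space n) (proj_space n)) (Lambda_stratum W F) = 0.
Proof.
move=> nF; apply: set_class0 => v [[/is_point_prod[/is_point_proj_space[i wi] _] wW _] v0].
case/negP: nF.
have eF : F = [set i | (\row_i @fst_coords K (proj_space n) (proj_space n) v i) 0 i == 0].
  by apply/setP => k; rewrite inE mxE -v0 ?inE // mevalXU.
apply/andP; split; first by rewrite eF; apply: flat_zero_set.
by apply/eqP => FT; move: wi; have := v0 i; rewrite FT !inE mevalXU => /(_ isT)->.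
Qed.

Theorem theorem1p3 (R : realType) (n : nat) (W : {vspace 'rV[R[i]]_n})
    (hW : (0 < \dim W < n)%N) :
  let M := config_matroid W in
  let L := lefschetz R[i] in
  K0_class (Lambda W) =
    \sum_(F : {set 'I_n} | flat M F && (F != [set: 'I_n]))
      eval_int (reduced_char_poly (contraction M F)) L *
      \sum_(i < #|'I_n| - rk (deletion M F)) L ^+ i.
Proof.
move=> M L.
pose PP := mp_prod (proj_space n) (proj_space n).
rewrite -set_class_points.
rewrite (set_class_strata (A := PP) (p := fun k => 'X_(lshift n k)) _ [set: 'I_n]); last first.
- exact: Lambda_locally_closed.
- by move=> k; apply: (multihomogeneousX _ (A := PP)).
(* The cut runs over all subsets [F]; those that are not proper flats contribute 0 on both sides. *)
rewrite [RHS]big_mkcond powersetT; apply: eq_big => [F|F _]; first by rewrite inE.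
case: ifPn => [/andP[fF FT]|/Lambda_stratum_eq0//].
(* A proper flat leaves an index [j] whose coordinate w_j is nonzero on the whole stratum, as the
   trivialization requires. *)
have [j jF] : exists j, j \notin F.
  by apply/existsP; apply: contraR FT => /existsPn h; apply/eqP/setP => k; rewrite inE; apply/negPn/h.
rewrite [LHS](class_Lambda_stratum W jF) class_open_stratum; congr (_ * _).
  rewrite reduced_char_polyE ?subsetT // eval_int_sum setTD; apply: eq_bigr => A _.
  rewrite eval_intZ eval_int_sum -mulrzl; congr (_ * _).
    by rewrite rmorphXn rmorphN1.
  by apply: eq_bigr => k _; rewrite eval_intXn.
(* A basis of maximal trace on [~: F] computes [rk (deletion M F)], and [relations_basis] then gives
   [relations W F] the vector space dimension n - [rk (deletion M F)]. *)
have [B hB eB] := rank_attained M (~: F).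
rewrite [LHS](class_proj_subspace (relations_basis hB eB)) rk_deletion setTD -eB.
by rewrite cardsCs setCK card_ord setDE setIC.
Qed.
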